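(* Let $\Sigma$ be a finite alphabet and let $G_1$ and $G_2$ be two (known) directed acyclic graphs on vertex set $[n]$ with in-degree at most $d$. Let $\mathcal D_1$ and $\mathcal D_2$ be the families of Bayesian networks over $\Sigma^n$ on $G_1$ and $G_2$ respectively. Then there is a distance approximation algorithm for $(\mathcal D_1,\mathcal D_2)$ that uses $m=\tilde O(|\Sigma|^{d+1}n\epsilon^{-2})$ samples and runs in $O(|\Sigma|^{d+1}mn)$ time.
   Context: A Bayesian network on a directed acyclic graph $G$ with vertex set $[n]$ is a distribution $P$ of $(X_1,\dots,X_n)$ over $\Sigma^n$ such that for every $i$, $X_i$ is conditionally independent of $X_{\text{non-descendants}(i)}$ given $X_{\text{parents}(i)}$ (parents and descendants taken in $G$); equivalently $P(x)=\prod_{i=1}^n\Pr_{X\sim P}[X_i=x_i\mid X_j=x_j\ \forall j\in\text{parents}(i)]$ for all $x\in\Sigma^n$. For families $\mathcal D_1,\mathcal D_2$ of distributions over $\Sigma^n$, a distance approximation algorithm for $(\mathcal D_1,\mathcal D_2)$ is a randomized algorithm which takes as input $\epsilon\in(0,1)$ and sample access to two unknown distributions $P\in\mathcal D_1$, $Q\in\mathcal D_2$, and outputs a value $\gamma\in[0,1]$ such that with probability at least $2/3$, $\gamma-\epsilon\le d_{TV}(P,Q)\le\gamma+\epsilon$. *)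

(* Defs.v *)
From HB Require Import structures.
From mathcomp Require Import all_boot all_order all_algebra.
From mathcomp Require Import all_classical all_reals exp.

Set Implicit Arguments.
Unset Strict Implicit.
Unset Printing Implicit Defensive.

Import Order.TTheory GRing.Theory Num.Theory.
Local Open Scope ring_scope.

(** * Finite distributions *)

Definition is_dist (R : realType) (T : finType) (P : T -> R) : Prop :=
  (forall x, 0 <= P x) /\ \sum_x P x = 1.

Definition dTV (R : realType) (T : finType) (P Q : T -> R) : R :=
  2^-1 * \sum_x `|P x - Q x|.

Definition Pr (R : realType) (T : finType) (P : T -> R) (E : pred T) : R :=
  \sum_(x | E x) P x.

Definition condPr (R : realType) (T : finType) (P : T -> R)
    (E F : pred T) : R :=
  Pr P [pred x | E x && F x] / Pr P F.

Definition iid (R : realType) (T : finType) (P : T -> R) (m : nat)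
    (xs : m.-tuple T) : R :=
  \prod_(i < m) P (tnth xs i).

(** * Bayesian networks; [G i j] is the edge from [i] to [j] *)

Definition word (S : finType) (n : nat) : finType := {ffun 'I_n -> S}.

Definition acyclic (n : nat) (G : rel 'I_n) : Prop :=
  forall i j, G i j -> ~~ connect G j i.

Definition parents (n : nat) (G : rel 'I_n) (i : 'I_n) : {set 'I_n} :=
  [set j | G j i].

(* [connect G] is reflexive, so [i] is not one of its own non-descendants. *)
Definition nondescendants (n : nat) (G : rel 'I_n) (i : 'I_n) : {set 'I_n} :=
  [set j | ~~ connect G i j].

Definition indegree_le (n : nat) (G : rel 'I_n) (d : nat) : Prop :=
  forall i, (#|parents G i| <= d)%N.

(* The event "X_j = x_j for all j in A". *)
Definition agree (S : finType) (n : nat) (A : {set 'I_n}) (x : word S n) :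
    pred (word S n) :=
  [pred y : word S n | [forall j in A, y j == x j]].

Definition cond_indep (R : realType) (S : finType) (n : nat)
    (P : word S n -> R) (A B C : {set 'I_n}) : Prop :=
  forall x : word S n, Pr P (agree C x) != 0 ->
    condPr P [pred y : word S n | agree A x y && agree B x y] (agree C x) =
    condPr P (agree A x) (agree C x) * condPr P (agree B x) (agree C x).

Definition bayes_net (R : realType) (S : finType) (n : nat) (G : rel 'I_n)
    (P : word S n -> R) : Prop :=
  is_dist P /\
  forall i, cond_indep P [set i] (nondescendants G i) (parents G i).

(** * Randomized real RAM with sample access to two sources

    Memory is split into countably many infinite arrays of natural numbers and
    of reals; a program text names finitely many of them.  Integer arithmetic
    is addition and truncated subtraction only.  Reals support the field
    operations and comparison, but cannot be rounded to integers, and the only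
    literals are natural numbers.  The only internal source of randomness is a
    fair coin. *)

Inductive iexp : Type :=
| INum of nat
| IGet of nat & iexp
| IAdd of iexp & iexp
| ISub of iexp & iexp.

Inductive rexp : Type :=
| ROfNat of iexp
| RGet of nat & iexp
| RAdd of rexp & rexp
| RSub of rexp & rexp
| RMul of rexp & rexp
| RDiv of rexp & rexp.

Inductive bexp : Type :=
| BLeI of iexp & iexp
| BLeR of rexp & rexp
| BNot of bexp.

Inductive source : Type := Src1 | Src2.

Inductive cmd : Type :=
| Skip
| ISet of nat & iexp & iexp
| RSet of nat & iexp & rexp
| Flip of nat & iexp
| Draw of source & nat
| Seq of cmd & cmd
| If of bexp & cmd & cmd
| While of bexp & cmd.

(* The random inputs not yet consumed are part of the state: the remaining
   samples from each source (a sample is the sequence of its letter codes) and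
   the remaining coin flips. *)
Record state (R : realType) : Type := State {
  imem : nat -> nat -> nat;
  rmem : nat -> nat -> R;
  samples1 : seq (seq nat);
  samples2 : seq (seq nat);
  coins : seq bool
}.

Definition upd (V : Type) (mem : nat -> nat -> V) (a k : nat) (v : V) :
    nat -> nat -> V :=
  fun a' k' => if (a' == a) && (k' == k) then v else mem a' k'.

(* Overwrites cells 0, ..., size v - 1 of array [a]. *)
Definition upd_block (mem : nat -> nat -> nat) (a : nat) (v : seq nat) :
    nat -> nat -> nat :=
  fun a' k' => if (a' == a) && (k' < size v)%N then nth 0%N v k'
               else mem a' k'.

Fixpoint ieval (R : realType) (s : state R) (e : iexp) : nat :=
  match e with
  | INum k => k
  | IGet a e1 => imem s a (ieval s e1)
  | IAdd e1 e2 => (ieval s e1 + ieval s e2)%N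
  | ISub e1 e2 => (ieval s e1 - ieval s e2)%N
  end.

Fixpoint reval (R : realType) (s : state R) (e : rexp) : R :=
  match e with
  | ROfNat e1 => (ieval s e1)%:R
  | RGet a e1 => rmem s a (ieval s e1)
  | RAdd e1 e2 => reval s e1 + reval s e2
  | RSub e1 e2 => reval s e1 - reval s e2
  | RMul e1 e2 => reval s e1 * reval s e2
  | RDiv e1 e2 => reval s e1 / reval s e2
  end.

Fixpoint beval (R : realType) (s : state R) (b : bexp) : bool :=
  match b with
  | BLeI e1 e2 => (ieval s e1 <= ieval s e2)%N
  | BLeR e1 e2 => reval s e1 <= reval s e2
  | BNot b1 => ~~ beval s b1
  end.

Definition set_imem (R : realType) (s : state R) (mem : nat -> nat -> nat) :
    state R :=
  State mem (rmem s) (samples1 s) (samples2 s) (coins s).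

Definition set_rmem (R : realType) (s : state R) (mem : nat -> nat -> R) :
    state R :=
  State (imem s) mem (samples1 s) (samples2 s) (coins s).

(* [exec c s t s']: from [s], program [c] halts in [s'] after [t] time units.
   Assignments, coin flips and tests cost one unit: expressions have a size
   fixed by the program text, so this is the number of machine operations up to
   a constant depending only on the program.  Drawing a sample also costs one
   unit per letter.  [Flip] and [Draw] are stuck once the corresponding random
   input is exhausted. *)
Inductive exec (R : realType) : cmd -> state R -> nat -> state R -> Prop :=
| ExecSkip s : exec Skip s 1%N s
| ExecISet a e1 e2 s :
    exec (ISet a e1 e2) s 1%N
      (set_imem s (upd (imem s) a (ieval s e1) (ieval s e2)))
| ExecRSet a e1 e2 s :
    exec (RSet a e1 e2) s 1%N
      (set_rmem s (upd (rmem s) a (ieval s e1) (reval s e2)))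
| ExecFlip a e s (b : bool) bs :
    coins s = b :: bs ->
    exec (Flip a e) s 1%N
      (State (upd (imem s) a (ieval s e) (nat_of_bool b)) (rmem s)
         (samples1 s) (samples2 s) bs)
| ExecDraw1 a s x xs :
    samples1 s = x :: xs ->
    exec (Draw Src1 a) s (size x).+1
      (State (upd_block (imem s) a x) (rmem s) xs (samples2 s) (coins s))
| ExecDraw2 a s x xs :
    samples2 s = x :: xs ->
    exec (Draw Src2 a) s (size x).+1
      (State (upd_block (imem s) a x) (rmem s) (samples1 s) xs (coins s))
| ExecSeq c1 c2 s t1 s1 t2 s2 :
    exec c1 s t1 s1 -> exec c2 s1 t2 s2 -> exec (Seq c1 c2) s (t1 + t2)%N s2
| ExecIfTrue b c1 c2 s t s' :
    beval s b -> exec c1 s t s' -> exec (If b c1 c2) s t.+1 s'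
| ExecIfFalse b c1 c2 s t s' :
    ~~ beval s b -> exec c2 s t s' -> exec (If b c1 c2) s t.+1 s'
| ExecWhileFalse b c s :
    ~~ beval s b -> exec (While b c) s 1%N s
| ExecWhileTrue b c s t1 s1 t2 s2 :
    beval s b -> exec c s t1 s1 -> exec (While b c) s1 t2 s2 ->
    exec (While b c) s (t1 + t2).+1%N s2.

(** * Distance approximation algorithms *)

(* Letters are coded by 0, ..., #|S| - 1. *)
Definition encode (S : finType) (n : nat) (x : word S n) : seq nat :=
  [seq nat_of_ord (enum_rank (x i)) | i <- enum 'I_n].

(* Real cell (0, 0) holds the input epsilon; real cell (0, 1) is the output. *)
Definition init (R : realType) (S : finType) (n : nat)
    (inp : nat -> nat -> nat) (eps : R)
    (xs ys : seq (word S n)) (bs : seq bool) : state R :=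
  State inp (upd (fun _ _ => 0) 0%N 0%N eps)
    (map (@encode S n) xs) (map (@encode S n) ys) bs.

Definition returns (R : realType) (c : cmd) (s : state R) (T : nat)
    (gamma : R) : Prop :=
  exists t s', [/\ exec c s t s', (t <= T)%N & rmem s' 0%N 1%N = gamma].

(* [c] is a distance approximation algorithm for (D1, D2) which, on accuracy
   [eps], takes at most [m eps] samples from each distribution and runs for at
   most [T eps] time units.  The sample and time bounds and the range of the
   output are required on every run.  [exec] is deterministic, so the run is a
   function of the [m eps] samples of each kind and of the coins; [T eps] coins
   suffice since each flip costs one unit. *)
Definition distance_approximation (R : realType) (S : finType) (n : nat)
    (D1 D2 : (word S n -> R) -> Prop) (c : cmd) (inp : nat -> nat -> nat)
    (m T : R -> nat) : Prop :=
  forall eps : R, 0 < eps < 1 ->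
  forall P Q : word S n -> R, D1 P -> D2 Q ->
    (forall (xs ys : (m eps).-tuple (word S n)) (bs : (T eps).-tuple bool),
       exists2 gamma, 0 <= gamma <= 1 &
         returns c (init inp eps xs ys bs) (T eps) gamma) /\
    2 / 3 <=
      \sum_(w : (m eps).-tuple (word S n) * (m eps).-tuple (word S n)
                * (T eps).-tuple bool
            | `[< exists2 gamma,
                    returns c (init inp eps w.1.1 w.1.2 w.2) (T eps) gamma &
                    gamma - eps <= dTV P Q <= gamma + eps >])
         iid P w.1.1 * iid Q w.1.2 * 2^-1 ^+ T eps.

(* Integer array 0 holds n, #|S| and d; arrays 1 and 2 hold the row-major
   adjacency matrices of the two graphs; all other cells are 0. *)
Definition adjacency (n : nat) (G : rel 'I_n) (k : nat) : nat :=
  [exists i : 'I_n, exists j : 'I_n, (k == i * n + j :> nat)%N && G i j].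

Definition network_input (n sigma d : nat) (G1 G2 : rel 'I_n) :
    nat -> nat -> nat :=
  fun a k => match a with
    | 0 => nth 0%N [:: n; sigma; d] k
    | 1 => adjacency G1 k
    | 2 => adjacency G2 k
    | _ => 0%N
    end.

(* Main.v *)
Require Import Defs.
From HB Require Import structures.
From mathcomp Require Import all_boot all_order all_algebra.
From mathcomp Require Import all_classical all_reals exp.
From mathcomp Require Import zify ring lra.

(** Learn each network by add-one smoothing of its conditional probability
    tables from N samples.  Given the samples, KL(P || hat P) is at most the sum
    over the vertices of E_P[p_i / hat p_i] - 1, and the expectation of that sum
    over the samples is at most n |S|^d (|S| - 1) / (N + 1); moreover dTV^2 <= KL.
    For the learned networks, dTV(hat P, hat Q) is the expectation of
    f = max(0, 1 - hat Q / hat P) under hat P.  Since 0 <= f <= 1, replacing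
    hat P by P costs at most dTV(P, hat P), so f is averaged over N fresh samples
    of P itself; no internal randomness is needed.  The mean square error of the
    average is O(|S|^(d+1) n / N), and Markov's inequality concludes. *)

Set Implicit Arguments.
Unset Strict Implicit.
Unset Printing Implicit Defensive.

Import Order.TTheory GRing.Theory Num.Theory.
Local Open Scope ring_scope.

(** * Expectation over independent samples *)

(** A success probability of 2/3 only asks for a second moment. Nothing is therefore shown
    simultaneously for all table entries: there is no concentration or union bound, and the sample
    size carries no logarithm. Smoothing makes every learned factor positive, so that all ratios
    make sense, and the denominator count + 1 that it creates has an expected inverse controlled by
    exchangeability alone. Rare parent assignments require no separate treatment: their larger error
    is weighted by their small probability, and each assignment contributes at most (|S| - 1) / (N +
    1). The machine shapes the rest. It has no integer multiplication and cannot round reals, so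
    keys into the count tables are built by repeated addition, and loops over samples compare an
    integer counter with a real bound. Memory starts at 0, so the tables need no initialisation. *)

Section Expectation.
Variables (R : realType) (T : finType) (P : T -> R).

(** Samples form a plain sequence rather than a tuple: induction on the length and splitting by
    [take] and [drop] then go without casts. *)
Fixpoint Eiid (m : nat) (G : seq T -> R) : R :=
  if m is m'.+1 then \sum_x P x * Eiid m' (fun s => G (x :: s)) else G [::].

Lemma EiidS m (G : seq T -> R) :
  Eiid m.+1 G = \sum_x P x * Eiid m (fun s => G (x :: s)).
Proof. by []. Qed.

Lemma sum1_inhabited : \sum_x P x = 1 -> inhabited T.
Proof.
case: (pickP (@predT T)) => [x _ _|none]; first by constructor.
rewrite big_pred0 // => E; have := oner_neq0 R; by rewrite -E eqxx.
Qed.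

Lemma Eiid_tuple m (G : seq T -> R) :
  \sum_(xs : m.-tuple T) iid P xs * G xs = Eiid m G.
Proof.
elim: m G => [|m IH] G /=.
  rewrite (big_pred1 [tuple]) => [|t]; first by rewrite /iid big_ord0 mul1r.
  by rewrite [t]tuple0; apply/esym/eqP/val_inj.
rewrite (reindex (fun p : T * m.-tuple T => [tuple of p.1 :: p.2])) /=; last first.
  exists (fun t : m.+1.-tuple T => (thead t, [tuple of behead t])).
    by move=> [x t] _; rewrite theadE; congr pair; apply/val_inj.
  by move=> t _; rewrite /= -tuple_eta.
rewrite -(pair_bigA _ (fun x (t : m.-tuple T) =>
  iid P [tuple of x :: t] * G (x :: t))) /=.
apply: eq_bigr => x _; rewrite -IH big_distrr /=; apply: eq_bigr => t _.
rewrite mulrA; congr (_ * _); rewrite /iid big_ord_recl tnth0.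
by congr (_ * _); apply: eq_bigr => i _; rewrite tnthS.
Qed.

Lemma eq_Eiid m (F G : seq T -> R) :
  (forall s, size s = m -> F s = G s) -> Eiid m F = Eiid m G.
Proof.
elim: m F G => [|m IH] F G FG /=; first exact: FG.
by apply: eq_bigr => x _; congr (_ * _); apply: IH => s sm; apply: FG; rewrite /= sm.
Qed.

Lemma EiidD m (F G : seq T -> R) : Eiid m (fun s => F s + G s) = Eiid m F + Eiid m G.
Proof.
elim: m F G => [|m IH] F G //=.
by rewrite -big_split; apply: eq_bigr => x _; rewrite /= IH mulrDr.
Qed.

Lemma EiidZ m c (F : seq T -> R) : Eiid m (fun s => c * F s) = c * Eiid m F.
Proof.
elim: m F => [|m IH] F //=.
by rewrite big_distrr; apply: eq_bigr => x _; rewrite /= IH mulrCA.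
Qed.

Lemma Eiid_sum m (I : finType) (F : I -> seq T -> R) :
  Eiid m (fun s => \sum_i F i s) = \sum_i Eiid m (F i).
Proof.
elim: m F => [|m IH] F //=.
by rewrite exchange_big; apply: eq_bigr => x _; rewrite /= IH big_distrr.
Qed.

Lemma Eiid_cat a b (G : seq T -> R) :
  Eiid (a + b) G = Eiid a (fun s1 => Eiid b (fun s2 => G (s1 ++ s2))).
Proof. by elim: a G => [|a IH] G //=; apply: eq_bigr => x _; rewrite IH. Qed.

(* Exchangeability: the m.+1 samples contribute equal terms. *)
Lemma Eiid_stein m (u : T -> R) (B : pred T) (F : nat -> R) :
  Eiid m.+1 (fun s => (\sum_(y <- s) u y) * F (count B s)) =
  m.+1%:R * \sum_x P x * (u x * Eiid m (fun s => F (B x + count B s)%N)).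
Proof.
elim: m F => [|m IH] F.
  rewrite mul1r /=; apply: eq_bigr => x _.
  by rewrite big_seq1.
have split_head x : Eiid m.+1 (fun s => (\sum_(y <- x :: s) u y) * F (count B (x :: s)))
   = u x * Eiid m.+1 (fun s => F (B x + count B s)%N)
     + Eiid m.+1 (fun s => (\sum_(y <- s) u y) * F (B x + count B s)%N).
  by rewrite -EiidZ -EiidD; apply: eq_Eiid => s _; rewrite big_cons mulrDl.
rewrite EiidS.
(* The head's contribution to the count moves into [F]; hence the induction quantifies over [F]. *)
under eq_bigr => x _ do rewrite split_head (IH (fun k => F (B x + k)%N)) mulrDr.
rewrite big_split -(natr1 m.+1) mulrDl mul1r addrC; congr (_ + _).
under eq_bigr => x _ do rewrite mulrCA mulr_sumr.
rewrite -mulr_sumr exchange_big; congr (_ * _); apply: eq_bigr => y _.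
rewrite EiidS !mulr_sumr; apply: eq_bigr => x _.
rewrite mulrCA; congr (_ * _); rewrite mulrCA; congr (_ * _); congr (_ * _).
by apply: eq_Eiid => s _; rewrite addnCA.
Qed.

Hypotheses (P0 : forall x, 0 <= P x) (P1 : \sum_x P x = 1).

Lemma Eiid_le m (F G : seq T -> R) :
  (forall s, size s = m -> F s <= G s) -> Eiid m F <= Eiid m G.
Proof.
elim: m F G => [|m IH] F G FG /=; first exact: FG.
apply: ler_sum => x _; apply: ler_wpM2l; first exact: P0.
by apply: IH => s sm; apply: FG; rewrite /= sm.
Qed.

Lemma Eiid_cst m (c : R) : Eiid m (fun=> c) = c.
Proof. by elim: m => [|m IH] //=; rewrite IH -big_distrl /= P1 mul1r. Qed.

(** Variances of independent centred terms add up. The offset [c] serves twice: in the induction it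
    absorbs the values already drawn, and in the application it carries the bias, so that bias and
    variance come out in one inequality. *)
Lemma Eiid_sq_sum_le m (g : T -> R) (v c : R) :
  \sum_x P x * g x = 0 -> \sum_x P x * g x ^+ 2 <= v ->
  Eiid m (fun s => (c + \sum_(y <- s) g y) ^+ 2) <= c ^+ 2 + m%:R * v.
Proof.
move=> g0 gv; elim: m c => [|m IH] c.
  by rewrite /= big_nil addr0 mul0r addr0.
rewrite EiidS.
have le x : P x * Eiid m (fun s => (c + \sum_(y <- x :: s) g y) ^+ 2) <=
    P x * (c ^+ 2 + m%:R * v) + (c *+ 2 * (P x * g x) + P x * g x ^+ 2).
  rewrite (_ : _ + (_ + _) = P x * ((c + g x) ^+ 2 + m%:R * v)); last by ring.
  apply: ler_wpM2l => //; apply: le_trans (IH _).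
  by apply: Eiid_le => s _; rewrite big_cons addrA.
apply: (le_trans (ler_sum _ (fun x _ => le x))).
rewrite !big_split /= -big_distrl -big_distrr /= P1 g0 mulr0 add0r mul1r.
by rewrite -(natr1 m) mulrDl mul1r addrA lerD2l.
Qed.

(* [Eiid_stein] with u the indicator of B and F k = 1/k, which is 0 at k = 0. *)
Lemma Eiid_inv_count_le m (B : pred T) :
  m.+1%:R * Pr P B * Eiid m (fun s => (count B s).+1%:R^-1) <= 1.
Proof.
have -> : m.+1%:R * Pr P B * Eiid m (fun s => (count B s).+1%:R^-1) =
    Eiid m.+1 (fun s => (\sum_(y <- s) (B y)%:R) * (count B s)%:R^-1).
  rewrite (Eiid_stein m (fun y => (B y)%:R) B (fun k => k%:R^-1)) -mulrA; congr (_ * _).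
  rewrite /Pr big_distrl big_mkcond; apply: eq_bigr => x _.
  by case: (B x); rewrite ?mul1r // mul0r mulr0.
rewrite -[leRHS](Eiid_cst m.+1 1); apply: Eiid_le => s _.
have -> : \sum_(y <- s) (B y)%:R = (count B s)%:R :> R.
  by rewrite -sum1_count natr_sum [RHS]big_mkcond; apply: eq_bigr => y _; case: (B y).
case: (count B s) => [|k]; first by rewrite mul0r ler01.
by rewrite divff // pnatr_eq0.
Qed.

(** For [B] inside [A] the ratio is 1 + (count of A minus B + s - 1) / (count of B + 1). A sample in
    A minus B leaves the count of [B] unchanged, so exchangeability and the bound on the inverse
    count give Pr(A minus B) / Pr(B); the pseudo-counts alone produce the error term. *)
Lemma Eiid_smoothed_ratio_le m (A B : pred T) (s : nat) :
  (0 < s)%N -> subpred B A -> 0 < Pr P B ->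
  Eiid m (fun xs => (count A xs + s)%:R / (count B xs).+1%:R) <=
  Pr P A / Pr P B + (s%:R - 1) / (m.+1%:R * Pr P B).
Proof.
move=> s0 BA q0; set q := Pr P B; set r := Pr P (predD A B).
have pE : Pr P A = q + r.
  rewrite /Pr (bigID B) /=; congr (_ + _); apply: eq_bigl => x.
    by rewrite andb_idl //; apply: BA.
  by rewrite /= andbC.
set e := Eiid m (fun xs => (count B xs).+1%:R^-1).
have e_le : e <= (m.+1%:R * q)^-1.
  rewrite -[leRHS]mul1r ler_pdivlMr; last by rewrite mulr_gt0 // ltr0n.
  by rewrite mulrC Eiid_inv_count_le.
have r_ge0 : 0 <= r by apply: sumr_ge0 => x _.
have E2 : Eiid m (fun xs => (\sum_(y <- xs) (predD A B y)%:R) * (count B xs).+1%:R^-1) <= r / q.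
  (* Exchangeability extracts one sample, so the empty sample is treated apart. *)
  case: m e e_le => [|m] e e_le.
    by rewrite /= big_nil mul0r divr_ge0 // ltW.
  rewrite (Eiid_stein m (fun y => (predD A B y)%:R) B (fun k => k.+1%:R^-1)).
  have -> : \sum_x P x * ((predD A B x)%:R * Eiid m (fun s => (B x + count B s).+1%:R^-1))
     = r * Eiid m (fun s => (count B s).+1%:R^-1).
    rewrite /r /Pr big_distrl [RHS]big_mkcond; apply: eq_bigr => x _.
    rewrite /=; case: (B x); first by rewrite mul0r mulr0.
    by case: (A x); rewrite ?mul1r // mul0r mulr0.
  rewrite mulrCA ler_wpM2l // -[leRHS]mul1r ler_pdivlMr //.
  by rewrite mulrAC Eiid_inv_count_le.
have -> : Eiid m (fun xs => (count A xs + s)%:R / (count B xs).+1%:R) =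
    1 + (Eiid m (fun xs => (\sum_(y <- xs) (predD A B y)%:R) * (count B xs).+1%:R^-1)
     + (s%:R - 1) * e).
  rewrite -[X in _ = X + _](Eiid_cst m 1) -EiidZ -!EiidD; apply: eq_Eiid => xs _.
  have -> : \sum_(y <- xs) (predD A B y)%:R = (count A xs)%:R - (count B xs)%:R :> R.
    elim: xs => [|x xs IH]; first by rewrite big_nil subrr.
    rewrite big_cons IH /= !natrD; have := BA x.
    by case: (B x) => [/(_ isT) ->|_] /=; [|case: (A x) => /=]; ring.
  have : (count B xs).+1%:R != 0 :> R by rewrite pnatr_eq0.
  rewrite -(natr1 (count B xs)) natrD; set b := _%:R => b0.
  by field; rewrite b0.
rewrite pE [(q + r) / q]mulrDl divff ?gt_eqF // -addrA lerD2l lerD //.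
by apply: ler_wpM2l => //; rewrite subr_ge0 ler1n.
Qed.

End Expectation.

(** * Factorization of Bayesian networks *)

Section BayesNet.
Variables (R : realType) (S : finType) (n : nat) (G : rel 'I_n).

Lemma agreeP (A : {set 'I_n}) (x y : word S n) :
  reflect {in A, y =1 x} (agree A x y).
Proof. exact: 'forall_in_eqP. Qed.

Lemma agree_refl (A : {set 'I_n}) (x : word S n) : agree A x x.
Proof. by apply/agreeP. Qed.

Lemma agree_eql (A : {set 'I_n}) (x z : word S n) :
  agree A x z -> agree A x =1 agree A z.
Proof.
move/agreeP => xz y; apply/agreeP/agreeP => H j jA; first by rewrite H ?xz.
by rewrite H // xz.
Qed.

Lemma agreeU (A B : {set 'I_n}) (x y : word S n) :
  agree (A :|: B) x y = agree A x y && agree B x y.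
Proof.
apply/agreeP/andP => [H|[/agreeP HA /agreeP HB] j].
  by split; apply/agreeP => j jA; apply: H; rewrite finset.in_setU jA ?orbT.
by rewrite finset.in_setU => /orP[/HA|/HB].
Qed.

Lemma agreeS (A B : {set 'I_n}) (x y : word S n) :
  A \subset B -> agree B x y -> agree A x y.
Proof. by move=> /fintype.subsetP AB /agreeP H; apply/agreeP => j /AB /H. Qed.

Lemma eq_Pr (P : word S n -> R) (E F : pred (word S n)) : E =1 F -> Pr P E = Pr P F.
Proof. by move=> EF; apply: eq_bigl. Qed.

Definition ancestral (U : {set 'I_n}) := forall i, i \in U -> parents G i \subset U.

Hypothesis acG : acyclic G.

Lemma acyclic_irr i : ~~ G i i.
Proof. by apply/negP => Gii; move: (acG Gii); rewrite connect0. Qed.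

(** A vertex of [U] with the fewest descendants works: a child in [U] would reach strictly fewer
    vertices, since by acyclicity it does not reach its parent. *)
Lemma ancestral_sink (U : {set 'I_n}) i0 : i0 \in U ->
  exists2 i, i \in U & forall j, j \in U -> ~~ G i j.
Proof.
move=> i0U; case: (arg_minnP (fun i => #|[set j | connect G i j]|) i0U) => i iU min_i.
exists i => // j jU; apply/negP => Gij.
have := min_i j jU; rewrite leqNgt => /negP; apply.
apply: proper_card; apply/properP; split.
  by apply/fintype.subsetP => k; rewrite !inE; apply: connect_trans; apply: connect1.
by exists i; rewrite !inE ?connect0 // acG.
Qed.

Lemma ancestral_connect (U : {set 'I_n}) j k : ancestral U -> k \in U ->
  connect G j k -> j \in U.
Proof.
move=> aU kU /connectP[p]; elim: p j => [|l p IH] j /=; first by move=> _ <-.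
move=> /andP[Gjl pl] kE; have lU := IH _ pl kE.
by apply: (fintype.subsetP (aU _ lU)); rewrite inE.
Qed.

(** Replaces a topological order. The added vertex has all its parents in [U], while [U] consists of
    its non-descendants: the setting of the local Markov property. *)
Lemma ancestral_ind (Q : {set 'I_n} -> Prop) :
  Q finset.set0 ->
  (forall (U : {set 'I_n}) i, i \notin U ->
     (forall j, j \in U -> ~~ G i j) ->
     parents G i \subset U -> U \subset nondescendants G i -> Q U -> Q (i |: U)) ->
  Q [set: 'I_n].
Proof.
move=> Q0 QS; have : ancestral [set: 'I_n] by move=> i _; rewrite finset.subsetT.
move: [set: 'I_n] => U; have [m] := ubnP #|U|; elim: m U => // m IH U Um aU.
have [->//|[i0 /ancestral_sink[i iU sink]]] := finset.set_0Vmem U.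
have UE : U = i |: U :\ i by rewrite finset.setD1K.
have a' : ancestral (U :\ i).
  move=> j /finset.setD1P[_ jU]; apply/fintype.subsetP => k; rewrite inE => Gkj.
  rewrite !inE (fintype.subsetP (aU _ jU)) ?inE // andbT.
  by apply/eqP => ki; move: (sink j jU); rewrite -ki Gkj.
rewrite UE; apply: QS => //.
- by rewrite !inE eqxx.
- by move=> j /finset.setD1P[_]; apply: sink.
- apply/fintype.subsetP => k; rewrite !inE => Gki.
  rewrite (fintype.subsetP (aU _ iU)) ?inE // andbT.
  by apply/eqP => ki; move: (acyclic_irr i); rewrite -{1}ki Gki.
(* A path from [i] to [j] would begin with a child of [i], which lies in [U] because [U] is
   ancestral; but [i] is a sink. *)
- apply/fintype.subsetP => j /finset.setD1P[ji jU]; rewrite inE.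
  apply/negP => /connectP[[|k p] /=]; first by move=> _ /eqP; rewrite (negPf ji).
  move=> /andP[Gik pk] jE; move: (sink k); rewrite Gik => /(_ _)/negP; apply => //.
  by apply: (ancestral_connect aU jU); apply/connectP; exists p.
- by apply: IH => //; move: Um; rewrite (cardsD1 i) iU.
Qed.

Definition replace (x : word S n) (i : 'I_n) (a : S) : word S n :=
  [ffun j => if j == i then a else x j].

(** Freezing words to [x0] outside [U] expresses a sum over the coordinates in [U] alone. The newest
    vertex is a sink, so only its own kernel depends on its letter, which can be summed out to 1. *)
Lemma sum_prod_kernels (k : 'I_n -> word S n -> R) (x0 : word S n) :
  (forall i x y, agree (i |: parents G i) x y -> k i y = k i x) ->
  (forall i x, \sum_a k i (replace x i a) = 1) ->
  \sum_x \prod_i k i x = 1.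
Proof.
move=> kdep ksum.
suff : \sum_(x | agree (~: [set: 'I_n]) x0 x) \prod_(i in [set: 'I_n]) k i x = 1.
  move=> H; rewrite -[RHS]H; apply: eq_big => [x|x _].
    by apply/esym/agreeP => i; rewrite finset.setCT inE.
  by apply: eq_bigl => i; rewrite finset.in_setT.
apply: (ancestral_ind (Q := fun U =>
  \sum_(x | agree (~: U) x0 x) \prod_(i in U) k i x = 1)).
  rewrite (big_pred1 x0) => [|x]; first by rewrite big_set0.
  rewrite finset.setC0; apply/agreeP/eqP => [H|-> //].
  by apply/ffunP => i; rewrite H.
move=> U i iU sinki paU _ IH; rewrite -[RHS]IH.
have irr := acyclic_irr.
(* Fibres of the map that resets coordinate [i]; each is parametrised by the letter at [i]. *)
rewrite (partition_big (fun x => replace x i (x0 i)) (agree (~: U) x0)) /=; last first.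
  move=> x /agreeP H; apply/agreeP => j; rewrite !inE ffunE => jU.
  by case: eqP => [->//|/eqP ji]; apply: H; rewrite !inE negb_or ji.
apply: eq_bigr => y /agreeP Hy.
rewrite (reindex_onto (replace y i) (fun x => x i)) /=; last first.
  move=> x /andP[_ /eqP <-]; apply/ffunP => j; rewrite !ffunE.
  by case: eqP => [->|].
rewrite (eq_bigl predT) => [|a]; last first.
  rewrite /= [replace y i a i]ffunE eqxx eqxx andbT; apply/andP; split.
    apply/agreeP => j; rewrite !inE negb_or => /andP[ji jU].
    by rewrite ffunE (negPf ji) Hy // inE.
  apply/eqP/ffunP => j; rewrite !ffunE; case: eqP => // ->.
  by rewrite -Hy // inE.
transitivity ((\sum_a k i (replace y i a)) * \prod_(j in U) k j y); last first.
  by rewrite ksum mul1r.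
rewrite mulr_suml; apply: eq_bigr => a _.
rewrite big_setU1 //=; congr (_ * _); apply: eq_bigr => j jU.
apply: kdep; apply/agreeP => l; rewrite ffunE; have [->|//] := eqVneq l i.
rewrite !inE => /orP[/eqP ij|Gij]; first by rewrite ij jU in iU.
by move: (sinki j jU); rewrite Gij.
Qed.

(** Law of total probability over the values on [B]. An assignment on [B] is represented by the one
    word that continues it by [x], that is, by a fixed point [z] of the overwriting map. *)
Lemma Pr_refine (P : word S n -> R) (E : pred (word S n)) (A B : {set 'I_n}) (x : word S n) :
  A \subset B ->
  Pr P [pred y | agree A x y && E y] =
  \sum_(z | agree A x z && ([ffun j => if j \in B then z j else x j] == z))
     Pr P [pred y | agree B z y && E y].
Proof.
move=> AB; rewrite /Pr.
set key := fun y : word S n => [ffun j => if j \in B then y j else x j] : word S n.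
rewrite (partition_big key (fun z => agree A x z && (key z == z))) /=; last first.
  move=> y /andP[/agreeP H _]; apply/andP; split.
    by apply/agreeP => j jA; rewrite ffunE (fintype.subsetP AB) ?H.
  by apply/eqP/ffunP => j; rewrite !ffunE; case: (j \in B).
apply: eq_big => z; first by [].
move=> /andP[/agreeP Hz /eqP kz]; apply: eq_bigl => y; rewrite andbAC; congr (_ && _).
apply/andP/agreeP => [[_ /eqP <-] j jB|H]; first by rewrite ffunE jB.
split; first by apply/agreeP => j jA; rewrite H ?Hz // (fintype.subsetP AB).
apply/eqP; rewrite -kz; apply/ffunP => j; rewrite !ffunE.
by case: ifP => // /H ->.
Qed.

Variable P : word S n -> R.
Hypothesis netP : bayes_net G P.

Lemma netP_ge0 x : 0 <= P x. Proof. by case: netP => -[]. Qed.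
Lemma netP_sum1 : \sum_x P x = 1. Proof. by case: netP => -[]. Qed.

Lemma Pr_gt0 (E : pred (word S n)) x : 0 < P x -> E x -> 0 < Pr P E.
Proof.
move=> Px Ex; apply: lt_le_trans Px _; rewrite /Pr (bigD1 x) //= lerDl.
by apply: sumr_ge0 => y _; apply: netP_ge0.
Qed.

Definition cpt (i : 'I_n) (x : word S n) : R :=
  Pr P (agree (i |: parents G i) x) / Pr P (agree (parents G i) x).

Lemma cpt_gt0 i x : 0 < P x -> 0 < cpt i x.
Proof. by move=> Px; rewrite divr_gt0 //; apply: Pr_gt0 Px (agree_refl _ _). Qed.

(** The Markov property speaks of the full set of non-descendants, while the induction conditions on
    a part [U] of it. Splitting by the values on all non-descendants, applying the property in each
    cell and summing back gives the factor for [U]. *)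
Lemma Pr_agreeU1 (U : {set 'I_n}) i x :
  parents G i \subset U -> U \subset nondescendants G i -> 0 < P x ->
  Pr P (agree (i |: U) x) = cpt i x * Pr P (agree U x).
Proof.
move=> paU Und Px.
have pa0 : Pr P (agree (parents G i) x) != 0 by rewrite gt_eqF // (Pr_gt0 Px) // agree_refl.
rewrite /cpt mulrAC; apply/(canRL (mulfK pa0)).
have -> : Pr P (agree (i |: U) x) = Pr P [pred y | agree U x y && agree [set i] x y].
  by apply: eq_Pr => y; rewrite agreeU andbC.
have -> : Pr P (agree U x) = Pr P [pred y | agree U x y && true].
  by apply: eq_Pr => y; rewrite /= andbT.
rewrite !(Pr_refine _ _ _ Und) big_distrl big_distrr /=; apply: eq_bigr => z.
move=> /andP[Uxz /eqP zE].
have pazE : agree (parents G i) x =1 agree (parents G i) z.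
  by apply: agree_eql; apply: agreeS Uxz.
have izE : agree [set i] x =1 agree [set i] z.
  apply: agree_eql; apply/agreeP => j; rewrite inE => /eqP->.
  by rewrite -zE ffunE inE connect0.
have zpa0 : Pr P (agree (parents G i) z) != 0 by rewrite -(eq_Pr _ pazE).
case: netP => _ /(_ i z zpa0); rewrite /condPr.
set B := nondescendants G i; set p := Pr P (agree (parents G i) z).
have BP y : agree B z y -> agree (parents G i) z y.
  by apply: agreeS; apply: fintype.subset_trans Und.
have -> : Pr P [pred y | [pred y | agree [set i] z y && agree B z y] y & agree (parents G i) z y]
    = Pr P [pred y | agree B z y && agree [set i] x y].
  apply: eq_Pr => y /=; rewrite izE; case By: (agree B z y); rewrite ?andbF //=.
  by rewrite (BP _ By) !andbT.
have -> : Pr P [pred y | agree [set i] z y & agree (parents G i) z y]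
    = Pr P (agree (i |: parents G i) x).
  by apply: eq_Pr => y /=; rewrite agreeU izE pazE.
have -> : Pr P [pred y | agree B z y & agree (parents G i) z y]
    = Pr P [pred y | agree B z y && true].
  by apply: eq_Pr => y /=; rewrite andbT andb_idr //; apply: BP.
rewrite -(eq_Pr P pazE) in zpa0 *; rewrite (eq_Pr P pazE) in zpa0 *.
rewrite -/p in zpa0 * => /(canRL (mulfVK zpa0)) ->.
by field.
Qed.

Lemma bayes_net_prod x : 0 < P x -> P x = \prod_i cpt i x.
Proof.
move=> Px; transitivity (Pr P (agree [set: 'I_n] x)).
  rewrite /Pr (big_pred1 x) // => y; apply/agreeP/eqP => [H|-> //].
  by apply/ffunP => j; rewrite H.
transitivity (\prod_(i in [set: 'I_n]) cpt i x); last first.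
  by apply: eq_bigl => i; rewrite finset.in_setT.
apply: (ancestral_ind (Q := fun U => Pr P (agree U x) = \prod_(i in U) cpt i x)).
  rewrite big_set0 -netP_sum1; apply: eq_bigl => y; apply/agreeP => j.
  by rewrite inE.
move=> U i iU _ paU Und IH.
by rewrite big_setU1 //= -IH Pr_agreeU1.
Qed.

(** Words that agree on [C] share the denominator, and their probabilities add up to at most that
    denominator, so each assignment to [C] contributes at most 1. With [C] the parents of a vertex
    this is the origin of the factor |S|^d. *)
Lemma sum_inv_Pr_agree_le (C : {set 'I_n}) :
  \sum_(x | 0 < P x) P x / Pr P (agree C x) <= (#|S| ^ #|C|)%:R.
Proof.
pose res (x : word S n) : {ffun 'I_#|C| -> S} := [ffun k => x (enum_val k)].
have resP x y : (res y == res x) = agree C x y.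
  apply/eqP/agreeP => [H j jC|H].
    by move/ffunP: H => /(_ (enum_rank_in jC j)); rewrite !ffunE enum_rankK_in.
  by apply/ffunP => k; rewrite !ffunE H // enum_valP.
have -> : (#|S| ^ #|C|)%:R = \sum_(c : {ffun 'I_#|C| -> S}) 1 :> R.
  by rewrite sumr_const card_ffun card_ord.
rewrite (partition_big res predT) //=; apply: ler_sum => c _.
have [[x0 /andP[Px0 /eqP x0c]]|none] := pselect (exists x, (0 < P x) && (res x == c)); last first.
  rewrite big_pred0 ?ler01 // => x; apply/negP => H; apply: none; by exists x.
rewrite (eq_bigr (fun x => P x / Pr P (agree C x0))); last first.
  move=> x /andP[_ /eqP xc]; congr (_ / _); apply: eq_Pr => y.
  by rewrite -!resP xc x0c.
rewrite -big_distrl /= ler_pdivrMr; last by apply: (Pr_gt0 Px0); apply: agree_refl.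
rewrite mul1r /Pr [leLHS]big_mkcond [leRHS]big_mkcond; apply: ler_sum => x _.
rewrite -x0c resP; case: (agree C x0 x); rewrite ?andbF // andbT.
by case: ifP => // _; apply: netP_ge0.
Qed.

End BayesNet.

(** * Total variation distance *)

Section TotalVariation.
Variables (R : realType) (T : finType).
Implicit Types P Q : T -> R.

Lemma dTVC P Q : dTV P Q = dTV Q P.
Proof. by congr (_ * _); apply: eq_bigr => x _; rewrite distrC. Qed.

Lemma dTV_ge0 P Q : 0 <= dTV P Q.
Proof. by apply: mulr_ge0; [rewrite invr_ge0 | apply: sumr_ge0]. Qed.

Lemma dTV_triangle P Q Q' : dTV P Q' <= dTV P Q + dTV Q Q'.
Proof.
rewrite /dTV -mulrDr ler_wpM2l ?invr_ge0 // -big_split; apply: ler_sum => x _.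
exact: ler_distD.
Qed.

Lemma dTV_lipschitz P Q P' Q' :
  `|dTV P Q - dTV P' Q'| <= dTV P P' + dTV Q Q'.
Proof.
have H1 := dTV_triangle P P' Q; have H2 := dTV_triangle P' Q' Q.
have H3 := dTV_triangle P' P Q'; have H4 := dTV_triangle P Q Q'.
rewrite (dTVC Q') in H2; rewrite (dTVC P' P) in H3.
by rewrite ler_norml; apply/andP; split; lra.
Qed.

Lemma expectation_lipschitz P Q (f : T -> R) :
  \sum_x P x = \sum_x Q x -> (forall x, 0 <= f x <= 1) ->
  `|\sum_x P x * f x - \sum_x Q x * f x| <= dTV P Q.
Proof.
(* Equal masses allow [f] to be centred at 1/2; its modulus is then at most 1/2, the factor in
   [dTV]. *)
move=> PQ f01; have -> : \sum_x P x * f x - \sum_x Q x * f x =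
    \sum_x (P x - Q x) * (f x - 2^-1).
  under [RHS]eq_bigr => x _ do rewrite mulrBr !mulrBl opprB addrA.
  rewrite !(sumrB, big_split) /= -!mulr_suml PQ; lra.
apply: (le_trans (ler_norm_sum _ _ _)); rewrite /dTV big_distrr /=.
apply: ler_sum => x _; rewrite normrM mulrC ler_wpM2r //.
by have /andP[? ?] := f01 x; rewrite ler_norml; apply/andP; split; lra.
Qed.

Definition excess (p q : R) : R := if q <= p then 1 - q / p else 0.

Lemma excess01 p q : 0 < p -> 0 <= q -> 0 <= excess p q <= 1.
Proof.
move=> p0 q0; rewrite /excess; case: ifP => [qp|_]; last by rewrite lexx ler01.
by rewrite subr_ge0 ler_pdivrMr // mul1r qp gerBl divr_ge0 // ltW.
Qed.

(** The positive part of p - q is (|p - q| + (p - q)) / 2, and the linear terms cancel in the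
    sum. *)
Lemma dTV_excess P Q : (forall x, 0 < P x) ->
  \sum_x P x = \sum_x Q x -> \sum_x P x * excess (P x) (Q x) = dTV P Q.
Proof.
move=> P0 PQ; have E x : P x * excess (P x) (Q x) =
    2^-1 * `|P x - Q x| + 2^-1 * (P x - Q x).
  rewrite /excess; case: (leP (Q x) (P x)) => QP.
    by rewrite ger0_norm ?subr_ge0 //; field; rewrite gt_eqF.
  by rewrite ltr0_norm ?subr_lt0 //; ring.
by rewrite (eq_bigr _ (fun x _ => E x)) big_split /= -!big_distrr /= sumrB PQ subrr mulr0 addr0.
Qed.

Lemma sum_cauchy_schwarz (a b : T -> R) : 0 < \sum_x b x ^+ 2 ->
  (\sum_x a x * b x) ^+ 2 <= (\sum_x a x ^+ 2) * (\sum_x b x ^+ 2).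
Proof.
set A := \sum_x a x ^+ 2; set B := \sum_x b x ^+ 2; set C := \sum_x a x * b x.
move=> B0; rewrite -subr_ge0 -(pmulr_rge0 _ B0).
have -> : B * (A * B - C ^+ 2) = \sum_x (B * a x - C * b x) ^+ 2.
  have E x : (B * a x - C * b x) ^+ 2 =
      B ^+ 2 * a x ^+ 2 - (B * C *+ 2) * (a x * b x) + C ^+ 2 * b x ^+ 2 by ring.
  rewrite (eq_bigr _ (fun x _ => E x)) big_split sumrB /= -!big_distrr /=.
  by rewrite -/A -/B -/C; ring.
by apply: sumr_ge0 => x _; apply: sqr_ge0.
Qed.

Lemma ln_prod (I : finType) (r : I -> R) :
  (forall i, 0 < r i) -> ln (\prod_i r i) = \sum_i ln (r i).
Proof.
move=> r0; suff [] : 0 < \prod_i r i /\ ln (\prod_i r i) = \sum_i ln (r i) by [].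
elim/big_rec2: _ => [|i y x _ [x0 xE]]; first by rewrite ln1.
by rewrite mulr_gt0 // lnM ?posrE // xE.
Qed.

(* The right-hand side dominates KL(P || Q), by the chain rule and ln t <= t - 1. *)
Lemma dTV_sq_le_sum_ratio (I : finType) P Q (p q : I -> T -> R) :
  (forall x, 0 <= P x) -> \sum_x P x = 1 -> \sum_x Q x = 1 ->
  (forall i x, 0 < P x -> 0 < p i x) ->
  (forall x, 0 < P x -> P x = \prod_i p i x) ->
  (forall i x, 0 < q i x) -> (forall x, Q x = \prod_i q i x) ->
  dTV P Q ^+ 2 <= \sum_i (\sum_(x | 0 < P x) P x * (p i x / q i x) - 1).
Proof.
move=> P0 P1 Q1 p0 PE q0 QE.
have Q0 x : 0 < Q x by rewrite QE; apply: prodr_gt0.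
pose a x := Num.sqrt (P x); pose b x := Num.sqrt (Q x).
have a2 x : a x ^+ 2 = P x by rewrite sqr_sqrtr.
have b2 x : b x ^+ 2 = Q x by rewrite sqr_sqrtr // ltW.
have a0 x : 0 <= a x by apply: sqrtr_ge0.
have b0 x : 0 < b x by rewrite sqrtr_gt0.
(* [BC] is the Bhattacharyya coefficient. Bounding b / a - 1 below by ln (b / a), and then
   linearising the logarithm factor by factor, gives 1 - BC <= K / 2. *)
set BC := \sum_x a x * b x; set K := \sum_i _.
have BC_ge : 1 - 2^-1 * K <= BC.
  have pointwise x : 0 < P x ->
      P x - 2^-1 * \sum_i (P x * (p i x / q i x) - P x) <= a x * b x.
    move=> Px; have ax : 0 < a x by rewrite sqrtr_gt0.
    have u0 : 0 < b x / a x by rewrite divr_gt0.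
    have lnu : ln (b x / a x) *+ 2 = \sum_i ln (q i x / p i x).
      rewrite -lnXn // expr_div_n b2 a2 -ln_prod => [|i]; last by rewrite divr_gt0 ?p0.
      by rewrite prodf_div -PE // -QE.
    have le1 : ln (b x / a x) <= b x / a x - 1.
      have := @le_ln1Dx R (b x / a x - 1); rewrite addrCA subrr addr0; apply.
      by rewrite -subr_gt0 opprK subrK.
    have le2 i : 1 - p i x / q i x <= ln (q i x / p i x).
      have r0 : 0 < p i x / q i x by rewrite divr_gt0 ?p0.
      rewrite -[q i x / _]invf_div lnV ?posrE // lerNr opprB.
      have := @le_ln1Dx R (p i x / q i x - 1); rewrite addrCA subrr addr0; apply.
      by rewrite -subr_gt0 opprK subrK.
    have le3 : \sum_i (1 - p i x / q i x) <= (b x / a x - 1) *+ 2.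
      by apply: (le_trans _ (ler_wMn2r 2 le1)); rewrite lnu; apply: ler_sum.
    have -> : \sum_i (P x * (p i x / q i x) - P x) = - (P x * \sum_i (1 - p i x / q i x)).
      by rewrite big_distrr -sumrN /=; apply: eq_bigr => i _; ring.
    have -> : a x * b x = P x * (b x / a x).
      by rewrite -a2; field; rewrite gt_eqF.
    have := ler_wpM2l (P0 x) le3; rewrite mulrnAr; lra.
  have PsumE : \sum_(x | 0 < P x) P x = 1.
    rewrite -P1 [LHS]big_mkcond; apply: eq_bigr => x _.
    by have := P0 x; rewrite le_eqVlt => /orP[/eqP <-|->] //; rewrite ltxx.
  have -> : K = \sum_(x | 0 < P x) \sum_i (P x * (p i x / q i x) - P x).
    by rewrite exchange_big /=; apply: eq_bigr => i _; rewrite sumrB PsumE.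
  rewrite -[X in X - _]PsumE mulr_sumr -sumrB.
  apply: (@le_trans _ _ (\sum_(x | 0 < P x) a x * b x)); first exact: ler_sum.
  rewrite /BC [leLHS]big_mkcond; apply: ler_sum => x _.
  by case: ifP => // _; rewrite mulr_ge0 ?(ltW (b0 x)).
have BC2 : \sum_x a x * b x *+ 2 = BC *+ 2 by rewrite -sumrMnl.
have A2 : \sum_x `|a x - b x| ^+ 2 = 2 - BC *+ 2.
  under eq_bigr => x _ do rewrite real_normK ?num_real // sqrrB a2 b2.
  by rewrite big_split sumrB /= P1 Q1 BC2; lra.
have B2 : \sum_x (a x + b x) ^+ 2 = 2 + BC *+ 2.
  under eq_bigr => x _ do rewrite sqrrD a2 b2.
  by rewrite !big_split /= P1 Q1 -/BC; lra.
have BC0 : 0 <= BC by apply: sumr_ge0 => x _; rewrite mulr_ge0 ?(ltW (b0 x)).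
have := @sum_cauchy_schwarz (fun x => `|a x - b x|) (fun x => a x + b x).
rewrite A2 B2; have -> : \sum_x `|a x - b x| * (a x + b x) = 2 * dTV P Q.
  rewrite /dTV mulrA divff ?mul1r ?pnatr_eq0 //; apply: eq_bigr => x _.
  rewrite -[X in _ * X]ger0_norm; last by rewrite addr_ge0 ?(ltW (b0 x)).
  by rewrite -normrM -subr_sqr a2 b2.
move=> /(_ _); have -> : 0 < 2 + BC *+ 2 by lra.
(* Cauchy-Schwarz has given dTV^2 <= 1 - BC^2, and 1 - BC^2 = 2 (1 - BC) - (1 - BC)^2 <= K. *)
move=> /(_ isT); have : 0 <= (1 - BC) ^+ 2 by apply: sqr_ge0.
rewrite exprMn -mulr_natr; set D := dTV P Q ^+ 2.
nra.
Qed.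

End TotalVariation.

(** * Smoothed estimates *)

Section Smoothing.
Variables (R : realType) (S : finType) (n : nat) (G : rel 'I_n).
Implicit Types (xs : seq (word S n)) (x : word S n).

Definition hcpt xs i x : R :=
  (count (agree (i |: parents G i) x) xs).+1%:R /
  (count (agree (parents G i) x) xs + #|S|)%:R.

Definition hnet xs x : R := \prod_i hcpt xs i x.

Lemma hcpt_gt0 xs i x : 0 < hcpt xs i x.
Proof.
rewrite divr_gt0 ?ltr0n // addn_gt0; apply/orP; right.
by apply/card_gt0P; exists (x i).
Qed.

Lemma hnet_gt0 xs x : 0 < hnet xs x.
Proof. by apply: prodr_gt0 => i _; apply: hcpt_gt0. Qed.

Hypothesis acG : acyclic G.

(** Every sample with the given parent values has exactly one letter at [i], so the numerators sum
    to the parent count plus |S|, which is the denominator; hence the factors are kernels. *)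
Lemma hnet_sum1 xs (x0 : word S n) : \sum_x hnet xs x = 1.
Proof.
apply: (sum_prod_kernels acG x0) => [i x y xy|i x].
  have H (A : {set 'I_n}) : A \subset i |: parents G i ->
    count (agree A y) xs = count (agree A x) xs.
    by move=> Asub; apply: eq_count => z; rewrite (agree_eql (agreeS Asub xy)).
  by rewrite /hcpt !H // finset.subsetUr.
have paE a : agree (parents G i) (replace x i a) =1 agree (parents G i) x.
  apply: agree_eql; apply/agreeP => j; rewrite inE ffunE => Gji.
  by case: eqP => // ji; move: (acyclic_irr acG i); rewrite -{1}ji Gji.
have famE a y : agree (i |: parents G i) (replace x i a) y =
    (y i == a) && agree (parents G i) x y.
  rewrite agreeU paE; congr (_ && _); apply/agreeP/eqP => [H|H j].
    by rewrite H ?inE // ffunE eqxx.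
  by rewrite inE => /eqP ->; rewrite ffunE eqxx.
have -> : \sum_a hcpt xs i (replace x i a) =
    \sum_a (count (fun y : word S n => (y i == a) && agree (parents G i) x y) xs).+1%:R /
            (count (agree (parents G i) x) xs + #|S|)%:R.
  by apply: eq_bigr => a _; rewrite /hcpt (eq_count (paE a)) (eq_count (famE a)).
rewrite -mulr_suml -natr_sum.
have -> : (\sum_a (count (fun y : word S n => (y i == a) && agree (parents G i) x y) xs).+1 =
    count (agree (parents G i) x) xs + #|S|)%N.
  under eq_bigr => a _ do rewrite -addn1.
  rewrite big_split /= sum1_card; congr (_ + _)%N.
  elim: xs => [|y ys IH] /=; first by rewrite big1.
  rewrite big_split /= IH; congr (_ + _)%N.
  rewrite (bigD1 (y i)) //= eqxx big1 ?addn0 // => a.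
  by rewrite eq_sym => /negPf ->.
rewrite divff // pnatr_eq0 -lt0n addn_gt0; apply/orP; right.
by apply/card_gt0P; exists (x i).
Qed.

Lemma Eiid_dTV_hnet_sq_le (P : word S n -> R) (N d : nat) :
  (0 < #|S|)%N -> indegree_le G d -> bayes_net G P ->
  Eiid P N (fun xs => dTV P (hnet xs) ^+ 2) <=
  n%:R * #|S|%:R ^+ d * (#|S|%:R - 1) / N.+1%:R.
Proof.
move=> S0 degG netP; have P0 := netP_ge0 netP; have P1 := netP_sum1 netP.
have [x0] := sum1_inhabited P1.
apply: (@le_trans _ _ (Eiid P N (fun xs =>
   \sum_i (\sum_(x | 0 < P x) P x * (cpt G P i x / hcpt xs i x) - 1)))).
  apply: Eiid_le => // xs _; apply: dTV_sq_le_sum_ratio => //.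
  - exact: hnet_sum1.
  - by move=> i x; apply: cpt_gt0.
  - exact: bayes_net_prod.
  - by move=> i x; apply: hcpt_gt0.
rewrite Eiid_sum -!mulrA mulr_natl -[in leRHS](card_ord n) -sumr_const.
apply: ler_sum => i _; set D := (_ * _).
have -> : Eiid P N (fun xs => \sum_(x | 0 < P x) P x * (cpt G P i x / hcpt xs i x) - 1)
   = Eiid P N (fun xs => \sum_(x | 0 < P x) P x * (cpt G P i x / hcpt xs i x)) - 1.
  rewrite EiidD; congr (_ + _).
  by rewrite Eiid_cst.
rewrite lerBlDr.
(* Multiplied by the true conditional probability, the main term of the smoothed ratio becomes
   exactly [P x]. Its sum is at most 1 and cancels the -1, so only the pseudo-count error
   remains. *)
have ratio x : 0 < P x ->
    Eiid P N (fun xs => P x * (cpt G P i x / hcpt xs i x)) <=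
    P x + (#|S|%:R - 1) / N.+1%:R * (P x / Pr P (agree (parents G i) x)).
  move=> Px; have p0 := Pr_gt0 netP Px (agree_refl (parents G i) x).
  have q0 := Pr_gt0 netP Px (agree_refl (i |: parents G i) x).
  have sub : subpred (agree (i |: parents G i) x) (agree (parents G i) x).
    by move=> y; apply: agreeS; apply: finset.subsetUr.
  have H := Eiid_smoothed_ratio_le P0 P1 N S0 sub q0.
  under eq_Eiid => xs _ do rewrite /hcpt invf_div mulrA.
  rewrite EiidZ; apply: (le_trans (ler_wpM2l _ H)).
    by rewrite mulr_ge0 // ltW // cpt_gt0.
  rewrite /cpt le_eqVlt; apply/orP; left; apply/eqP.
  have : N.+1%:R != 0 :> R by rewrite pnatr_eq0.
  by move: N.+1%:R => N1 N1_0; field; rewrite N1_0 !gt_eqF.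
have -> : Eiid P N (fun xs => \sum_(x | 0 < P x) P x * (cpt G P i x / hcpt xs i x)) =
   \sum_(x | 0 < P x) Eiid P N (fun xs => P x * (cpt G P i x / hcpt xs i x)).
  rewrite [RHS]big_mkcond; transitivity (Eiid P N (fun xs =>
      \sum_x if 0 < P x then P x * (cpt G P i x / hcpt xs i x) else 0)).
    by apply: eq_Eiid => xs _; rewrite big_mkcond.
  by rewrite Eiid_sum; apply: eq_bigr => x _; case: ifP => // _; rewrite Eiid_cst.
apply: (le_trans (ler_sum _ ratio)).
rewrite big_split -mulr_sumr /= addrC lerD //.
  rewrite /D mulrC; apply: ler_wpM2r.
    by rewrite mulr_ge0 ?invr_ge0 // subr_ge0 ler1n.
  apply: (le_trans (sum_inv_Pr_agree_le netP _)); rewrite -natrX ler_nat.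
  by rewrite leq_pexp2l.
by rewrite -P1 [leLHS]big_mkcond; apply: ler_sum => x _; case: ifP.
Qed.

End Smoothing.

(** * Mean square error of the distance estimator *)

Definition estimate (R : realType) (S : finType) (n : nat) (G1 G2 : rel 'I_n)
    (xs ys zs : seq (word S n)) : R :=
  (\sum_(z <- zs) excess (hnet R G1 xs z) (hnet R G2 ys z)) / (size zs)%:R.

Section Estimate.
Variables (R : realType) (S : finType) (n : nat) (G1 G2 : rel 'I_n).

Lemma estimate01 xs ys (zs : seq (word S n)) : 0 <= estimate R G1 G2 xs ys zs <= 1.
Proof.
have e01 z := excess01 (hnet_gt0 R G1 xs z) (ltW (hnet_gt0 R G2 ys z)).
apply/andP; split.
  by rewrite mulr_ge0 ?invr_ge0 //; apply: sumr_ge0 => z _; case/andP: (e01 z).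
case: zs => [|z0 zs]; first by rewrite /estimate big_nil mul0r ler01.
rewrite /estimate; set s := z0 :: zs; rewrite ler_pdivrMr ?ltr0n // mul1r.
rewrite -sum1_size natr_sum; apply: ler_sum => z _; by case/andP: (e01 z).
Qed.

Hypotheses (S0 : (0 < #|S|)%N) (ac1 : acyclic G1) (ac2 : acyclic G2).
Variables (d N : nat) (P Q : word S n -> R).
Hypotheses (deg1 : indegree_le G1 d) (deg2 : indegree_le G2 d).
Hypotheses (netP : bayes_net G1 P) (netQ : bayes_net G2 Q).
Hypotheses (N0 : (0 < N)%N) (n0 : (0 < n)%N).

Lemma Eiid_estimate_given xs ys :
  Eiid P N (fun zs => (estimate R G1 G2 xs ys zs - dTV P Q) ^+ 2) <=
  5 * (dTV P (hnet R G1 xs) ^+ 2 + dTV Q (hnet R G2 ys) ^+ 2) + N%:R^-1.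
Proof.
have P0 := netP_ge0 netP; have P1 := netP_sum1 netP.
have [x0] := sum1_inhabited P1.
set hP := hnet R G1 xs; set hQ := hnet R G2 ys.
pose f z := excess (hP z) (hQ z); pose mu := \sum_z P z * f z.
have f01 z : 0 <= f z <= 1 by apply: excess01; rewrite ?ltW //; apply: hnet_gt0.
have hP1 : \sum_x hP x = 1 := hnet_sum1 R ac1 xs x0.
have hQ1 : \sum_x hQ x = 1 := hnet_sum1 R ac2 ys x0.
(* [dTV P hP] enters twice: the test points come from [P] instead of [hP], and the estimated
   distance is that of the learned pair. *)
have bias : `|mu - dTV P Q| <= 2 * dTV P hP + dTV Q hQ.
  have H1 : `|mu - dTV hP hQ| <= dTV P hP.
    rewrite -(dTV_excess (hnet_gt0 R G1 xs)) ?hP1 ?hQ1 //.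
    by apply: expectation_lipschitz; rewrite ?hP1.
  have H2 := dTV_lipschitz P Q hP hQ.
  have := ler_distD (dTV hP hQ) mu (dTV P Q).
  rewrite [`|dTV hP hQ - _|]distrC; lra.
(* Cauchy-Schwarz with the vector (2, 1), hence 5 = 4 + 1. *)
have bias2 : (mu - dTV P Q) ^+ 2 <= 5 * (dTV P hP ^+ 2 + dTV Q hQ ^+ 2).
  rewrite -real_normK ?num_real //.
  have : `|mu - dTV P Q| ^+ 2 <= (2 * dTV P hP + dTV Q hQ) ^+ 2.
    apply: lerXn2r bias; rewrite nnegrE //.
    by apply: addr_ge0; [apply: mulr_ge0 => //|]; apply: dTV_ge0.
  move=> H; apply: (le_trans H).
  have : 0 <= (dTV P hP - 2 * dTV Q hQ) ^+ 2 by apply: sqr_ge0.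
  lra.
have N0R : 0 < N%:R :> R by rewrite ltr0n.
(* Everything is scaled by N: the offset is N times the bias, and each term has variance at most 1
   because [f] and [mu] lie in [0, 1]. *)
have := @Eiid_sq_sum_le R _ P P0 P1 N (fun z => f z - mu) 1 (N%:R * (mu - dTV P Q)).
have -> : \sum_x P x * (f x - mu) = 0.
  by under eq_bigr => x _ do rewrite mulrBr; rewrite sumrB -mulr_suml P1 mul1r subrr.
have mu01 : 0 <= mu <= 1.
  apply/andP; split.
    by apply: sumr_ge0 => z _; rewrite mulr_ge0 //; case/andP: (f01 z).
  rewrite -P1; apply: ler_sum => z _; rewrite -[leRHS]mulr1 ler_wpM2l //.
  by case/andP: (f01 z).
move=> /(_ erefl) H.
have : Eiid P N (fun s => (N%:R * (mu - dTV P Q) + \sum_(y <- s) (f y - mu)) ^+ 2) <=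
   (N%:R * (mu - dTV P Q)) ^+ 2 + N%:R * 1.
  apply: H; rewrite -[leRHS]P1; apply: ler_sum => z _.
  rewrite -[leRHS]mulr1 ler_wpM2l // -real_normK ?num_real // exprn_ile1 //.
  have /andP[? ?] := f01 z; have /andP[? ?] := mu01.
  by rewrite ler_norml; apply/andP; split; lra.
have E : Eiid P N (fun s => (N%:R * (mu - dTV P Q) + \sum_(y <- s) (f y - mu)) ^+ 2) =
   N%:R ^+ 2 * Eiid P N (fun zs => (estimate R G1 G2 xs ys zs - dTV P Q) ^+ 2).
  rewrite -EiidZ; apply: eq_Eiid => zs sz; rewrite -exprMn /estimate sz; congr (_ ^+ 2).
  rewrite sumrB big_const_seq count_predT iter_addr_0 sz -mulr_natl -/hP -/hQ -/(f _).
  by field; rewrite gt_eqF.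
rewrite E mulr1 exprMn -[X in _ + X]mulr1 -[X in _ + X * _](@mulfK _ N%:R) ?gt_eqF //.
rewrite -[_ / N%:R * 1]mulrA mulr1 -expr2 -mulrDr ler_pM2l ?exprn_gt0 // => H2.
by apply: (le_trans H2); rewrite lerD2r.
Qed.

(** 11 = 5 + 5 + 1: two learning errors and the variance 1 / N, each bounded through the same
    quantity |S|^(d+1) n / N. *)
Lemma Eiid_estimate_sq_le :
  Eiid P N (fun xs => Eiid Q N (fun ys => Eiid P N (fun zs =>
    (estimate R G1 G2 xs ys zs - dTV P Q) ^+ 2))) <=
  11 * (#|S|%:R ^+ d.+1 * n%:R) / N%:R.
Proof.
have P0 := netP_ge0 netP; have P1 := netP_sum1 netP.
have Q0 := netP_ge0 netQ; have Q1 := netP_sum1 netQ.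
apply: (@le_trans _ _ (Eiid P N (fun xs => Eiid Q N (fun ys =>
  5 * (dTV P (hnet R G1 xs) ^+ 2 + dTV Q (hnet R G2 ys) ^+ 2) + N%:R^-1)))).
  apply: Eiid_le => // xs _; apply: Eiid_le => // ys _; exact: Eiid_estimate_given.
under eq_Eiid => xs _.
  rewrite EiidD Eiid_cst // EiidZ EiidD Eiid_cst //.
  over.
rewrite EiidD Eiid_cst // EiidZ EiidD Eiid_cst //.
have HP := Eiid_dTV_hnet_sq_le ac1 N S0 deg1 netP.
have HQ := Eiid_dTV_hnet_sq_le ac2 N S0 deg2 netQ.
have delta_le : n%:R * #|S|%:R ^+ d * (#|S|%:R - 1) / N.+1%:R <=
    #|S|%:R ^+ d.+1 * n%:R / N%:R :> R.
  apply: ler_pM.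
  - by rewrite !mulr_ge0 // ?exprn_ge0 // subr_ge0 ler1n.
  - by rewrite invr_ge0.
  - rewrite exprSr -subr_ge0 (_ : _ - _ = n%:R * #|S|%:R ^+ d); last by ring.
    by rewrite mulr_ge0 ?exprn_ge0.
  - by rewrite lef_pV2 ?posrE ?ltr0n // ler_nat.
have one_le : N%:R^-1 <= #|S|%:R ^+ d.+1 * n%:R / N%:R :> R.
  rewrite -[leLHS]mul1r ler_wpM2r ?invr_ge0 // -natrX -natrM ler1n.
  by rewrite muln_gt0 expn_gt0 S0.
move: HP HQ; set eP := Eiid _ _ _; set eQ := Eiid _ _ _ => HP HQ.
have {}HP := le_trans HP delta_le; have {}HQ := le_trans HQ delta_le.
rewrite -[leRHS]mulrA; move: one_le HP HQ; set X := _ * n%:R / _; set Ninv := _^-1.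
by move: eP eQ X Ninv => eP eQ X Ninv; lra.
Qed.
End Estimate.

(** * Running programs *)

Section HoareRules.
Variable R : realType.
Implicit Types (s : state R) (c : cmd) (Q : state R -> Prop).

(** Total correctness with a time bound; for a postcondition on the output cell it unfolds to
    [returns]. *)
Definition runs c s (T : nat) Q :=
  exists t s', [/\ exec c s t s', (t <= T)%N & Q s'].

Lemma runs_weaken c s T T' Q Q' : runs c s T Q -> (T <= T')%N ->
  (forall s', Q s' -> Q' s') -> runs c s T' Q'.
Proof.
move=> [t [s' [cs tT Qs]]] TT QQ; exists t, s'; split=> //; last exact: QQ.
exact: leq_trans TT.
Qed.

Lemma runs_skip s Q : Q s -> runs Skip s 1 Q.
Proof. by move=> Qs; exists 1%N, s; split=> //; constructor. Qed.

Lemma runs_iset a e1 e2 s Q :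
  Q (set_imem s (upd (imem s) a (ieval s e1) (ieval s e2))) ->
  runs (ISet a e1 e2) s 1 Q.
Proof. by move=> Qs; exists 1%N; eexists; split; [constructor| |exact: Qs]. Qed.

Lemma runs_rset a e1 e2 s Q :
  Q (set_rmem s (upd (rmem s) a (ieval s e1) (reval s e2))) ->
  runs (RSet a e1 e2) s 1 Q.
Proof. by move=> Qs; exists 1%N; eexists; split; [constructor| |exact: Qs]. Qed.

Lemma runs_seq c1 c2 s T1 T2 Q1 Q2 : runs c1 s T1 Q1 ->
  (forall s', Q1 s' -> runs c2 s' T2 Q2) -> runs (Seq c1 c2) s (T1 + T2) Q2.
Proof.
move=> [t1 [s1 [e1 l1 q1]]] /(_ s1 q1)[t2 [s2 [e2 l2 q2]]].
by exists (t1 + t2)%N, s2; split; [apply: ExecSeq e1 e2 | apply: leq_add | ].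
Qed.

Lemma runs_if b c1 c2 s T Q :
  (beval s b -> runs c1 s T Q) -> (~~ beval s b -> runs c2 s T Q) ->
  runs (If b c1 c2) s T.+1 Q.
Proof.
move=> H1 H2; case: (boolP (beval s b)) => hb.
  by have [t [s' [? ? ?]]] := H1 hb; exists t.+1, s'; split=> //; apply: ExecIfTrue.
by have [t [s' [? ? ?]]] := H2 hb; exists t.+1, s'; split=> //; apply: ExecIfFalse.
Qed.

Lemma runs_while b c (I : nat -> state R -> Prop) N T s :
  I 0%N s ->
  (forall k s', (k < N)%N -> I k s' -> beval s' b /\ runs c s' T (I k.+1)) ->
  (forall s', I N s' -> ~~ beval s' b) ->
  runs (While b c) s (N * T.+1).+1 (I N).
Proof.
move=> I0 step stop.
suff H m k s' : (k + m = N)%N -> I k s' -> runs (While b c) s' (m * T.+1).+1 (I N).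
  exact: (H N 0%N).
elim: m k s' => [|m IH] k s1 kN Ik.
  rewrite addn0 in kN; rewrite -kN in stop *; exists 1%N, s1; split=> //.
  by apply: ExecWhileFalse; apply: stop.
have [hb [t [s2 [e2 l2 q2]]]] := step k s1 ltac:(lia) Ik.
have [t3 [s3 [e3 l3 q3]]] := IH k.+1 s2 ltac:(lia) q2.
by exists (t + t3).+1, s3; split=> //; [apply: ExecWhileTrue e2 e3 | nia].
Qed.

End HoareRules.

Notation var a := (IGet a (INum 0)) (only parsing).

Definition assign (a : nat) (e : iexp) : cmd := ISet a (INum 0) e.

Definition increment (a : nat) : cmd := assign a (IAdd (var a) (INum 1)).

Definition for_loop (v : nat) (e : iexp) (c : cmd) : cmd :=
  Seq (assign v (INum 0))
      (While (BNot (BLeI e (var v))) (Seq c (increment v))).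

(** The invariant is asserted once the counter has been advanced, so it must survive that write.
    Each round pays 2 units for the test and the increment; the final 2 are the initialisation and
    the failing test. *)
Lemma runs_for (R : realType) v e c N T (I : nat -> state R -> Prop) s :
  I 0%N (set_imem s (upd (imem s) v 0 0)) ->
  (forall k s', imem s' v 0 = k -> I k s' -> ieval s' e = N) ->
  (forall k s', (k < N)%N -> imem s' v 0 = k -> I k s' ->
     runs c s' T (fun s'' => imem s'' v 0 = k /\
       I k.+1 (set_imem s'' (upd (imem s'') v 0 k.+1)))) ->
  runs (for_loop v e c) s (N * (T + 2) + 2) (I N).
Proof.
move=> I0 eN step; rewrite addnC.
apply: runs_weaken (runs_seq (Q1 := fun s' => imem s' v 0 = 0%N /\ I 0%N s')
   (T1 := 1) (T2 := (N * (T + 1).+1).+1) (Q2 := fun s' => imem s' v 0 = N /\ I N s') _ _) _ _.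
- by apply: runs_iset; rewrite /= /upd !eqxx.
- move=> s' H; apply: (runs_while (I := fun k s' => imem s' v 0 = k /\ I k s')) => //.
    move=> k {H}s' kN [vk Ik]; split; first by rewrite /= (eN _ _ vk Ik) vk -ltnNge.
    apply: runs_seq (step k s' kN vk Ik) _ => s'' [vk' Ik'].
    apply: runs_iset; rewrite /= vk' addn1; split=> //.
    by rewrite /upd !eqxx.
  by move=> {H}s' [vN IN]; rewrite /= (eN _ _ vN IN) vN leqnn.
- by lia.
- by move=> s' [].
Qed.

Lemma upd_same (V : Type) (mem : nat -> nat -> V) a k v : upd mem a k v a k = v.
Proof. by rewrite /upd !eqxx. Qed.

Lemma upd_other (V : Type) (mem : nat -> nat -> V) a k v a' k' :
  a' <> a -> upd mem a k v a' k' = mem a' k'.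
Proof. by rewrite /upd; case: eqP. Qed.

Section Framing.
Variable R : realType.
Implicit Types s : state R.

(** Scratch arrays are numbered consecutively, so an interval of array numbers describes a frame. *)
Definition same_but (lo hi : nat) s s' :=
  [/\ forall a k, ~~ (lo <= a <= hi)%N -> imem s' a k = imem s a k,
      rmem s' = rmem s, samples1 s' = samples1 s, samples2 s' = samples2 s
    & coins s' = coins s].

Lemma same_but_trans lo hi s s1 s2 :
  same_but lo hi s s1 -> same_but lo hi s1 s2 -> same_but lo hi s s2.
Proof.
move=> [f1 a1 b1 c1 d1] [f2 a2 b2 c2 d2].
by split; [move=> a k h; rewrite f2 // f1 | rewrite a2 | rewrite b2 | rewrite c2 | rewrite d2].
Qed.

Lemma same_but_weaken lo hi lo' hi' s s1 : (lo' <= lo)%N -> (hi <= hi')%N ->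
  same_but lo hi s s1 -> same_but lo' hi' s s1.
Proof. by move=> l h [f ? ? ? ?]; split=> // a k H; apply: f; lia. Qed.

Lemma same_but_upd lo hi s a k v : (lo <= a <= hi)%N ->
  same_but lo hi s (set_imem s (upd (imem s) a k v)).
Proof. by move=> H; split=> // a' k' H' /=; rewrite upd_other //; lia. Qed.

End Framing.

(** * Keys into the count tables, in base |S| *)

Definition nvar : iexp := var 0.
Definition sigma : iexp := IGet 0 (INum 1).
Definition degree : iexp := IGet 0 (INum 2).

(* Integer arrays: 3 sample buffer; 4 table index; 5, 6, 7 scratch; 8 current
   vertex i; 9 offset i * d of its parent list; 10 sample counter; 11, 12, 13
   parent lists, parent counts and family counts of the first network, and
   14, 15, 16 those of the second.
   Real arrays: 1 sample bound; 2, 3 learned likelihoods; 4 running sum. *)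
Definition push_digit (e : iexp) : cmd :=
  Seq (assign 5 (INum 0))
  (Seq (for_loop 6 sigma (assign 5 (IAdd (var 5) (var 4))))
       (assign 4 (IAdd (var 5) e))).

(** The vertex number is the leading coefficient, so that one table serves all vertices; the digits
    after it are the letters at the parents. *)
Definition parent_key (p : nat) : cmd :=
  Seq (assign 4 (var 8))
      (for_loop 7 degree
         (push_digit (IGet 3 (ISub nvar (IGet p (IAdd (var 9) (var 7))))))).

(** Training and evaluation visit the same keys: [c1] acts at the parent key and [c2] at the family
    key, which has one more digit. *)
Definition sweep (p : nat) (c1 c2 : cmd) : cmd :=
  Seq (assign 9 (INum 0))
  (for_loop 8 nvar
     (Seq (parent_key p)
     (Seq c1
     (Seq (push_digit (IGet 3 (var 8)))
     (Seq c2
          (assign 9 (IAdd (var 9) degree))))))).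

Fixpoint horner_key (q : nat) (f : nat -> nat) (k0 s : nat) : nat :=
  if s is s'.+1 then (horner_key q f k0 s' * q + f s')%N else k0.

(** Quotient and remainder by [q] peel off the last digit. Both expansions have the same length, so
    leading zeros cause no ambiguity. *)
Lemma horner_key_inj q f g k l s :
  (forall t, (t < s)%N -> (f t < q)%N) -> (forall t, (t < s)%N -> (g t < q)%N) ->
  (horner_key q f k s == horner_key q g l s) =
  (k == l) && [forall t : 'I_s, f t == g t].
Proof.
elim: s => [|s IH] fq gq /=; first by rewrite [X in _ && X](_ : _ = true) ?andbT //;
  apply/forallP => -[].
have fs := fq s (ltnSn s); have gs := gq s (ltnSn s).
have {}IH := IH (fun t ts => fq t (ltnW ts)) (fun t ts => gq t (ltnW ts)).
apply/eqP/andP => [E|[/eqP kl /forallP fg]].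
  have q0 : (0 < q)%N by lia.
  have [E1 E2] : horner_key q f k s = horner_key q g l s /\ f s = g s.
    have := congr1 (fun z => (z %/ q)%N) E; have := congr1 (fun z => (z %% q)%N) E.
    by rewrite /= !divnMDl // !modnMDl !modn_small // !divn_small // !addn0.
  move/eqP: E1; rewrite IH => /andP[-> /forallP fg]; split=> //.
  apply/forallP => -[t /=]; rewrite ltnS leq_eqVlt => /orP[/eqP->|ts]; first exact/eqP.
  exact: (fg (Ordinal ts)).
congr (_ * _ + _)%N; last exact/eqP/(fg ord_max).
apply/eqP; rewrite IH kl eqxx; apply/forallP => t.
exact: (fg (widen_ord (leqnSn s) t)).
Qed.

Section ProgramPieces.
Variable R : realType.
Implicit Types s : state R.

(** A Horner step without multiplication: array 5 accumulates |S| copies of the old key, at the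
    price of a factor |S| in time. [e] is evaluated after this loop, so its value has to survive
    changes to arrays 5 and 6. *)
Lemma runs_push_digit e v s :
  (forall s', same_but 5 6 s s' -> ieval s' e = v) ->
  runs (push_digit e) s (3 * imem s 0 1 + 4)
    (fun s' => same_but 4 6 s s' /\ imem s' 4 0 = imem s 4 0 * imem s 0 1 + v)%N.
Proof.
move=> ev; set q := imem s 0 1; set x := imem s 4 0.
apply: (runs_weaken (T := (1 + ((q * (1 + 2) + 2) + 1))%N)); [|lia|by move=> s'; exact].
apply: runs_seq; first by apply: runs_iset; exact: erefl.
move=> _ <-; apply: runs_seq.
  apply: (runs_for (I := fun k s' => same_but 5 6 s s' /\ imem s' 5 0 = (k * x)%N) (N := q)).
  - split; last by rewrite /= mul0n.
    by split=> // a k H; rewrite /= !upd_other //; lia.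
  - by move=> k s' _ [[f _ _ _ _] _]; rewrite /= f.
  - move=> k s' kq vk [[f ? ? ? ?] xk]; apply: runs_iset; split=> //=.
    split; last by rewrite /upd /= xk f // -/x mulSn addnC.
    by split=> // a j H; rewrite /= !upd_other ?f //; lia.
move=> s' [ss xq]; apply: runs_iset; split=> /=; last by rewrite /upd /= xq (ev _ ss) mulnC.
have ss' := same_but_weaken (leqnSn 4) (leqnn 6) ss.
by apply: same_but_trans ss' _; apply: same_but_upd.
Qed.

Lemma runs_parent_key p s : (9 < p)%N ->
  runs (parent_key p) s (imem s 0 2 * (3 * imem s 0 1 + 6) + 3)
    (fun s' => same_but 4 7 s s' /\ imem s' 4 0 =
       horner_key (imem s 0 1) (fun t => imem s 3 (imem s 0 0 - imem s p (imem s 9 0 + t)))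
         (imem s 8 0) (imem s 0 2))%N.
Proof.
move=> p9; set q := imem s 0 1; set d := imem s 0 2.
set f := fun t : nat => imem s 3 _.
apply: (runs_weaken (T := (1 + (d * (3 * q + 4 + 2) + 2))%N)); [|lia|by move=> s'; exact].
apply: runs_seq; first by apply: runs_iset; exact: erefl.
move=> _ <-.
apply: (runs_for (I := fun k s' => same_but 4 7 s s' /\
  imem s' 4 0 = horner_key q f (imem s 8 0) k) (N := d)) =>
    [|k s' _ [[fr _ _ _ _] _]|k s' kd vk [ss xk]].
- by split=> //; split=> // a k H; rewrite /= !upd_other //; lia.
- by rewrite /= fr.
have fr : forall a j, ~~ (4 <= a <= 7)%N -> imem s' a j = imem s a j by case: ss.
rewrite /q -(fr 0%N) //; apply: (runs_weaken _ (leqnn _)).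
  apply: (runs_push_digit (v := f k)) => s1 [fr1 _ _ _ _] /=.
  by rewrite !fr1 ?vk //= ?fr //; lia.
move=> s1 [ss1 E]; have [fr1 _ _ _ _] := ss1; split; first by rewrite fr1.
have ss2 : same_but 4 7 s s1.
  by apply: same_but_trans ss _; apply: same_but_weaken ss1.
split; last by rewrite /= /upd /= E xk fr.
by apply: same_but_trans ss2 _; apply: same_but_upd.
Qed.

End ProgramPieces.

(** * Tables of counts *)

Definition bump_at (a : nat) : cmd := ISet a (var 4) (IAdd (IGet a (var 4)) (INum 1)).

Definition train (p tp tf : nat) : cmd := sweep p (bump_at tp) (bump_at tf).

Definition evaluate (p tp tf r : nat) : cmd :=
  Seq (RSet r (INum 0) (ROfNat (INum 1)))
  (sweep p
     (RSet r (INum 0)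
        (RDiv (RGet r (INum 0)) (ROfNat (IAdd (IGet tp (var 4)) sigma))))
     (RSet r (INum 0)
        (RMul (RGet r (INum 0)) (ROfNat (IAdd (IGet tf (var 4)) (INum 1)))))).

Section Sweep.
Variables (R : realType) (n q d : nat) (par buf : nat -> nat).
Implicit Types s : state R.

Definition pkey (i : nat) : nat :=
  horner_key q (fun t => buf (n - par (i * d + t))%N) i d.

Definition fkey (i : nat) : nat := (pkey i * q + buf i)%N.

Definition sweep_context (p : nat) s :=
  [/\ imem s 0 0 = n, imem s 0 1 = q, imem s 0 2 = d,
      forall k, imem s 3 k = buf k & forall k, imem s p k = par k].

Definition preserves (p : nat) s s' :=
  forall a k, (a <= 9)%N || (a == p) -> imem s' a k = imem s a k.

Lemma sweep_context_preserved p s s' : preserves p s s' -> sweep_context p s -> sweep_context p s'.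
Proof.
move=> H [h0 h1 h2 h3 h4]; split=> [| | |k|k]; rewrite H ?eqxx ?orbT //.
Qed.

Lemma sweep_context_same_but p s s' : (9 < p)%N ->
  same_but 4 9 s s' -> sweep_context p s -> sweep_context p s'.
Proof.
move=> p9 [f _ _ _ _] [h0 h1 h2 h3 h4].
by split=> [| | |k|k]; rewrite f //; lia.
Qed.

(** Halfway through a vertex the effect of [c1] is one step ahead of that of [c2], hence the
    intermediate invariant [J']. Both invariants must tolerate the key computations, which write to
    arrays 4 to 9. *)
Lemma runs_sweep p c1 c2 s (J J' : nat -> state R -> Prop) : (9 < p)%N ->
  (forall i s1 s2, same_but 4 9 s1 s2 -> J i s1 -> J i s2) ->
  (forall i s1 s2, same_but 4 9 s1 s2 -> J' i s1 -> J' i s2) ->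
  (forall i s1, (i < n)%N -> sweep_context p s1 -> imem s1 4 0 = pkey i -> J i s1 ->
     runs c1 s1 1 (fun s2 => preserves p s1 s2 /\ J' i s2)) ->
  (forall i s1, (i < n)%N -> sweep_context p s1 -> imem s1 4 0 = fkey i -> J' i s1 ->
     runs c2 s1 1 (fun s2 => preserves p s1 s2 /\ J i.+1 s2)) ->
  sweep_context p s -> J 0%N s ->
  runs (sweep p c1 c2) s (n * (d * (3 * q + 6) + 3 * q + 12) + 3)
    (fun s' => sweep_context p s' /\ J n s').
Proof.
move=> p9 stabJ stabJ' run1 run2 ctx J0.
apply: (runs_weaken (T := (1 + (n * (d * (3 * q + 6) + 3 + (1 + (3 * q + 4 + (1 + 1))) + 2) + 2))%N)
  (Q := fun s' => (sweep_context p s' /\ imem s' 9 0 = n * d /\ J n s')%N)); last 2 first.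
- lia.
- by move=> s' [? []].
apply: runs_seq; first by apply: runs_iset; exact: erefl.
move=> _ <-.
apply: (runs_for (N := n) (I := fun k s' => sweep_context p s' /\ imem s' 9 0 = (k * d)%N /\
  J k s')).
- set s1 := set_imem _ _; have ss : same_but 4 9 s s1.
    by split=> // a k H; rewrite /= !upd_other //; lia.
  by split; [apply: sweep_context_same_but ctx | split; last apply: stabJ J0].
- by move=> k s' _ [[h0 _ _ _ _] _]; rewrite /= h0.
move=> i s1 lt_in i8 [ctx1 [b9 Ji]]; have [h0 h1 h2 h3 h4] := ctx1.
have := @runs_parent_key R p s1 p9; rewrite h1 h2 => run_key.
apply: runs_seq run_key _ => s2 [ss2 k2].
have ss2' : same_but 4 9 s1 s2 by apply: same_but_weaken ss2.
have ctx2 := sweep_context_same_but p9 ss2' ctx1.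
have k2' : imem s2 4 0 = pkey i.
  rewrite k2 i8 /pkey h0 b9; congr (horner_key _ _ _ _).
  by apply/funext => t; rewrite h3 h4.
have fr2 a k : ~~ (4 <= a <= 7)%N -> imem s2 a k = imem s1 a k by case: ss2 => H _ _ _ _; apply: H.
apply: runs_seq (run1 i s2 lt_in ctx2 k2' (stabJ _ _ _ ss2' Ji)) _ => s3 [pr3 J3].
have ctx3 := sweep_context_preserved pr3 ctx2; have [g0 g1 g2 g3 g4] := ctx3.
have i3 : imem s3 8 0 = i by rewrite pr3 // fr2.
have b3 : imem s3 9 0 = (i * d)%N by rewrite pr3 // fr2.
have := @runs_push_digit R (IGet 3 (var 8)) (buf i) s3; rewrite g1 => run_push.
apply: runs_seq; first apply: run_push.
  by move=> s' [f _ _ _ _] /=; rewrite !f // i3 g3.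
move=> s4 [ss4 k4].
have ss4' : same_but 4 9 s3 s4 by apply: same_but_weaken ss4.
have ctx4 := sweep_context_same_but p9 ss4' ctx3.
have fr4 a k : ~~ (4 <= a <= 6)%N -> imem s4 a k = imem s3 a k by case: ss4 => H _ _ _ _; apply: H.
have k4' : imem s4 4 0 = fkey i by rewrite k4 pr3 // k2'.
apply: runs_seq (run2 i s4 lt_in ctx4 k4' (stabJ' _ _ _ ss4' J3)) _ => s5 [pr5 J5].
have ctx5 := sweep_context_preserved pr5 ctx4; have [f0 f1 f2 f3 f4] := ctx5.
apply: runs_iset; split; first by rewrite /= upd_other // pr5 // fr4.
set s6 := set_imem _ _; have ss : same_but 4 9 s5 s6.
  by split=> // a k H; rewrite /= !upd_other //; lia.
split; first by apply: sweep_context_same_but ctx5.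
split; last by apply: stabJ J5.
by rewrite /= upd_other // upd_same pr5 // fr4 // b3 f2 mulSn addnC.
Qed.

Lemma runs_train p tp tf s :
  (9 < p)%N -> (9 < tp)%N -> (9 < tf)%N -> p != tp -> p != tf -> tp != tf ->
  sweep_context p s ->
  runs (train p tp tf) s (n * (d * (3 * q + 6) + 3 * q + 12) + 3)
    (fun s' =>
       [/\ forall a k, ~~ (4 <= a <= 9)%N -> a != tp -> a != tf ->
             imem s' a k = imem s a k,
           forall k, imem s' tp k = (imem s tp k + \sum_(i < n) (pkey i == k))%N,
           forall k, imem s' tf k = (imem s tf k + \sum_(i < n) (fkey i == k))%N &
           [/\ rmem s' = rmem s, samples1 s' = samples1 s & samples2 s' = samples2 s]]).
Proof.
move=> p9 tp9 tf9 ptp ptf tptf ctx.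
(* [i] counts the vertices entered in the parent table, [j] those entered in the family table. *)
pose J0 i j s' :=
       [/\ forall a k, ~~ (4 <= a <= 9)%N -> a != tp -> a != tf ->
             imem s' a k = imem s a k,
           forall k, imem s' tp k = (imem s tp k + \sum_(0 <= t < i) (pkey t == k))%N,
           forall k, imem s' tf k = (imem s tf k + \sum_(0 <= t < j) (fkey t == k))%N &
           [/\ rmem s' = rmem s, samples1 s' = samples1 s & samples2 s' = samples2 s]].
have stab i j s1 s2 : same_but 4 9 s1 s2 -> J0 i j s1 -> J0 i j s2.
  move=> [f e1 e2 e3 _] [h1 h2 h3 [h4 h5 h6]]; split=> [a k ? ? ?|k|k|].
  - by rewrite f ?h1.
  - by rewrite f ?h2 //; lia.
  - by rewrite f ?h3 //; lia.
  - by rewrite e1 e2 e3.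
apply: (runs_weaken (runs_sweep (J := fun i => J0 i i) (J' := fun i => J0 i.+1 i)
   p9 _ _ _ _ ctx _)).
- by move=> i; apply: stab.
- by move=> i; apply: stab.
- move=> i s1 lt_in ctx1 k1 [h1 h2 h3 [h4 h5 h6]]; apply: runs_iset; split.
    by move=> a k H /=; rewrite upd_other //; lia.
  split=> //= [a k ? ? ?|k|k].
  - by rewrite upd_other ?h1 //; lia.
  - rewrite big_nat_recr //= addnA -h2 /upd eqxx k1 /= [pkey i == k]eq_sym.
    by case: eqP => [<-|_]; rewrite ?addn1 ?addn0.
  - by rewrite upd_other ?h3 //; lia.
- move=> i s1 lt_in ctx1 k1 [h1 h2 h3 [h4 h5 h6]]; apply: runs_iset; split.
    by move=> a k H /=; rewrite upd_other //; lia.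
  split=> //= [a k ? ? ?|k|k].
  - by rewrite upd_other ?h1 //; lia.
  - by rewrite upd_other ?h2 //; lia.
  - rewrite big_nat_recr //= addnA -h3 /upd eqxx k1 /= [fkey i == k]eq_sym.
    by case: eqP => [<-|_]; rewrite ?addn1 ?addn0.
- by split=> // k; rewrite big_geq // addn0.
- by [].
- move=> s' [_ [h1 h2 h3 h4]]; split=> // k; first by rewrite h2 big_mkord.
  by rewrite h3 big_mkord.
Qed.

Lemma runs_evaluate p tp tf r s :
  (9 < p)%N -> (9 < tp)%N -> (9 < tf)%N -> sweep_context p s ->
  runs (evaluate p tp tf r) s (n * (d * (3 * q + 6) + 3 * q + 12) + 4)
    (fun s' =>
       [/\ forall a k, ~~ (4 <= a <= 9)%N -> imem s' a k = imem s a k,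
           forall a k, a != r -> rmem s' a k = rmem s a k,
           rmem s' r 0 = \prod_(i < n) ((imem s tf (fkey i)).+1%:R /
                                       (imem s tp (pkey i) + q)%:R),
           samples1 s' = samples1 s & samples2 s' = samples2 s]).
Proof.
move=> p9 tp9 tf9 ctx.
(* Numerators and denominators advance separately, because the division for a vertex precedes its
   multiplication. *)
pose J0 i j s' :=
       [/\ forall a k, ~~ (4 <= a <= 9)%N -> imem s' a k = imem s a k,
           forall a k, a != r -> rmem s' a k = rmem s a k,
           rmem s' r 0 = (\prod_(0 <= t < i) (imem s tf (fkey t)).+1%:R) /
                         (\prod_(0 <= t < j) (imem s tp (pkey t) + q)%:R),
           samples1 s' = samples1 s & samples2 s' = samples2 s].
have stab i j s1 s2 : same_but 4 9 s1 s2 -> J0 i j s1 -> J0 i j s2.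
  move=> [f e1 e2 e3 _] [h1 h2 h3 h4 h5]; split; rewrite ?e1 ?e2 ?e3 //.
  by move=> a k ?; rewrite f ?h1.
apply: (runs_weaken (T := (1 + (n * (d * (3 * q + 6) + 3 * q + 12) + 3))%N));
  [|lia|by move=> s'; exact].
apply: runs_seq; first by apply: runs_rset; exact: erefl.
move=> _ <-; set s0 := set_rmem _ _.
have ctx0 : sweep_context p s0 by [].
apply: (runs_weaken (runs_sweep (J := fun i => J0 i i) (J' := fun i => J0 i i.+1)
   p9 _ _ _ _ ctx0 _)).
- by move=> i; apply: stab.
- by move=> i; apply: stab.
- move=> i s1 lt_in [g0 g1 g2 g3 g4] k1 [h1 h2 h3 h4 h5]; apply: runs_rset; split=> //.
  split=> //= [a k ar|]; first by rewrite upd_other ?h2 //; apply/eqP.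
  rewrite upd_same h3 k1 g1 h1; last by lia.
  rewrite [in RHS]big_nat_recr //=.  by rewrite invfM mulrA.
- move=> i s1 lt_in [g0 g1 g2 g3 g4] k1 [h1 h2 h3 h4 h5]; apply: runs_rset; split=> //.
  split=> //= [a k ar|]; first by rewrite upd_other ?h2 //; apply/eqP.
  rewrite upd_same h3 k1 h1; last by lia.
  rewrite addn1 [in RHS]big_nat_recr //=. by rewrite mulrAC.
- split=> //= [a k ar|]; first by rewrite upd_other //; apply/eqP.
  by rewrite upd_same !big_geq // divr1.
- by [].
- move=> s' [_ [h1 h2 h3 h4 h5]]; split=> //; rewrite h3 !big_mkord.
  by rewrite prodf_div.
Qed.

End Sweep.

(** * Parent lists from the adjacency matrices *)

Definition list_parents (g p : nat) : cmd :=
  Seq (assign 9 (INum 0))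
  (for_loop 8 nvar
     (Seq (assign 4 (var 9))
     (Seq (assign 5 (var 8))
     (Seq
       (for_loop 7 nvar
          (Seq (If (BLeI (INum 1) (IGet g (var 5)))
                 (Seq (ISet p (var 4) (ISub nvar (var 7))) (increment 4))
                 Skip)
               (assign 5 (IAdd (var 5) nvar))))
       (assign 9 (IAdd (var 9) degree)))))).

Section ListParents.
Variables (R : realType) (n d : nat) (A : nat -> nat -> bool).
Implicit Types s : state R.

(* Vertex j is stored as n - j, so that the initial value 0 of an unused slot
   points at the buffer cell n, which always holds 0. *)
Definition lists_row (par : nat -> nat) (i : nat) : Prop :=
  (forall t, (t < d)%N -> par (i * d + t)%N = 0%N \/
     exists2 j, (j < n)%N && A j i & par (i * d + t)%N = (n - j)%N) /\
  (forall j, (j < n)%N -> A j i -> exists2 t, (t < d)%N & par (i * d + t)%N = (n - j)%N).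

(** Slots past the write position still hold 0: this becomes the padding of a short row and leaves
    the following rows blank. *)
Definition row_prefix (i j : nat) (s0 s : state R) (p : nat) : Prop :=
  let c := count (A^~ i) (iota 0 j) in
  [/\ imem s 4 0 = (i * d + c)%N, imem s 5 0 = (j * n + i)%N,
      forall k, (k < i * d)%N -> imem s p k = imem s0 p k,
      forall k, (i * d + c <= k)%N -> imem s p k = 0%N &
      (forall t, (t < c)%N -> exists2 j', (j' < j)%N && A j' i & imem s p (i * d + t) = (n - j')%N) /\
      (forall j', (j' < j)%N -> A j' i -> exists2 t, (t < c)%N & imem s p (i * d + t) = (n - j')%N)].

Definition outside_same (p : nat) s s' :=
  [/\ forall a k, ~~ (4 <= a <= 9)%N -> a != p -> imem s' a k = imem s a k,
      rmem s' = rmem s, samples1 s' = samples1 s & samples2 s' = samples2 s].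

(** The lists are built once, in time of order n^2; scanning the matrix again for every sample would
    exceed the time bound, which is linear in n per sample. Column [i] is traversed by adding n to
    the index, again for want of multiplication. *)
Lemma runs_list_parents g p s :
  (9 < p)%N -> (g < 4)%N -> imem s 0 0 = n -> imem s 0 2 = d ->
  (forall i j, (i < n)%N -> (j < n)%N -> imem s g (j * n + i) = A j i) ->
  (forall k, imem s p k = 0%N) ->
  (forall i, (i < n)%N -> (count (A^~ i) (iota 0 n) <= d)%N) ->
  runs (list_parents g p) s (n * (n * 7 + 9) + 3)
    (fun s' => outside_same p s s' /\ forall i, (i < n)%N -> lists_row (imem s' p) i).
Proof.
move=> p9 g4 n_s d_s adj p_s deg.
apply: (runs_weaken (T := (1 + (n * ((1 + (1 + ((n * ((4 + 1) + 2) + 2) + 1))) + 2) + 2))%N));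
  [|lia|by move=> s'; exact].
apply: runs_seq; first by apply: runs_iset; exact: erefl.
move=> _ <-.
apply: (runs_weaken (runs_for (N := n) (I := fun i s' =>
   [/\ outside_same p s s', imem s' 9 0 = (i * d)%N,
       forall k, (i * d <= k)%N -> imem s' p k = 0%N &
       forall i', (i' < i)%N -> lists_row (imem s' p) i']) _ _ _)) => [|||//|s' [? _ _ rows]//].
- split=> //=; last by move=> k _; rewrite !upd_other //; lia.
  split=> // a k H ap; rewrite /= !upd_other //; lia.
- by move=> k s' _ [[f _ _ _] _ _ _] /=; rewrite f //; lia.
move=> i s1 lt_in i1 [os1 b1 z1 rows1].
have f1 : forall a k, ~~ (4 <= a <= 9)%N -> a != p -> imem s1 a k = imem s a k by case: os1.
apply: runs_seq; first by apply: runs_iset; exact: erefl.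
move=> _ <-; apply: runs_seq; first by apply: runs_iset; exact: erefl.
move=> _ <-; set s2 := set_imem _ _.
apply: (runs_seq (Q1 := fun s' => [/\ outside_same p s s', imem s' 8 0 = i,
   imem s' 9 0 = (i * d)%N & row_prefix i n s1 s' p])).
  apply: (runs_weaken (runs_for (N := n) (I := fun j s' =>
     [/\ outside_same p s s', imem s' 8 0 = i, imem s' 9 0 = (i * d)%N & row_prefix i j s1 s' p])
     _ _ _)) => [|||//|//].
  - split=> //.
      case: os1 => f e1 e2 e3; split=> // a k H ap; rewrite /= !upd_other ?f //; lia.
    split=> //=.
    + by rewrite upd_other // /upd /= b1 addn0.
    + by move=> k kd; rewrite !upd_other //; lia.
    + by move=> k; rewrite addn0 => kd; rewrite !upd_other ?z1 //; lia.
  - by move=> k s' _ [[f _ _ _] _ _ _] /=; rewrite f //; lia.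
  move=> j s3 lt_jn j3 [os3 i3 b3 [x4 x5 low high [sound complete]]].
  have f3 : forall a k, ~~ (4 <= a <= 9)%N -> a != p -> imem s3 a k = imem s a k by case: os3.
  have g3 : imem s3 g (imem s3 5 0) = A j i by rewrite x5 f3 ?adj //; lia.
  set c := count _ _ in x4 high sound complete.
  have cS : count (A^~ i) (iota 0 j.+1) = (c + A j i)%N.
    by rewrite -addn1 iotaD count_cat /= add0n addn0.
  apply: (runs_seq (Q1 := fun s' => [/\ outside_same p s s', imem s' 8 0 = i,
     imem s' 9 0 = (i * d)%N, imem s' 7 0 = j & [/\
      imem s' 4 0 = (i * d + (c + A j i))%N, imem s' 5 0 = (j * n + i)%N,
      forall k, (k < i * d)%N -> imem s' p k = imem s1 p k,
      forall k, (i * d + (c + A j i) <= k)%N -> imem s' p k = 0%N &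
      (forall t, (t < c + A j i)%N -> exists2 j', (j' < j.+1)%N && A j' i & imem s' p (i * d + t) = (n - j')%N) /\
      (forall j', (j' < j.+1)%N -> A j' i ->
        exists2 t, (t < c + A j i)%N & imem s' p (i * d + t) = (n - j')%N)]])).
    apply: (runs_if (T := 3)) => /=; rewrite g3.
      move=> Aji; have {}Aji : A j i by case: (A j i) Aji.
      rewrite Aji; apply: (runs_weaken (T := (1 + 1)%N)); [|by []|by move=> s'; exact].
      apply: runs_seq; first by apply: runs_iset; exact: erefl.
      move=> _ <-; apply: runs_iset; rewrite /= x4 j3.
      have n3 : imem s3 0 0 = n by rewrite f3 //; lia.
      have p0 k v : upd (upd (imem s3) p (i * d + c)%N (n - j)%N) 4 0 v p k =
           if k == (i * d + c)%N then (n - j)%N else imem s3 p k.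
        rewrite upd_other; last by lia.
        by rewrite /upd eqxx.
      split.
      + case: os3 => f e1 e2 e3; split=> // a k H ap; rewrite /= !upd_other ?f //; try exact/eqP.
        by lia.
      + by rewrite /= !upd_other //; lia.
      + by rewrite /= !upd_other //; lia.
      + by rewrite /= !upd_other //; lia.
      split.
      + by rewrite /= upd_same upd_other ?x4; lia.
      + by rewrite /= !upd_other //; lia.
      + by move=> k kd; rewrite /= n3 p0 ltn_eqF ?low //; lia.
      + by move=> k kd; rewrite /= n3 p0 gtn_eqF ?high //; lia.
      split.
      + move=> t tc; rewrite /= n3 p0 eqn_add2l; case: eqP => [_|tne].
          by exists j => //; rewrite ltnSn.
        have [|j' /andP[j'j Aj'] E] := sound t; first by lia.
        by exists j' => //; rewrite Aj' andbT ltnS ltnW.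
      + move=> j'; rewrite ltnS leq_eqVlt => /orP[/eqP-> _|j'j Aj'].
          by exists c; [lia | rewrite /= n3 p0 eqxx].
        have [t tc E] := complete j' j'j Aj'.
        by exists t; [lia | rewrite /= n3 p0 eqn_add2l ltn_eqF].
    move=> Aji; have {}Aji : A j i = false by case: (A j i) Aji.
    apply: (runs_weaken (T := 1%N)); [|by []|by move=> s'; exact].
    apply: runs_skip; rewrite Aji addn0; split=> //; split=> //; split.
      move=> t /sound[j' /andP[j'j Aj'] E].
      by exists j' => //; rewrite Aj' andbT ltnS ltnW.
    move=> j'; rewrite ltnS leq_eqVlt => /orP[/eqP->|j'j Aj']; first by rewrite Aji.
    exact: complete.
  move=> s4 [os4 i4 b4 j4 [y4 y5 low4 high4 [sound4 complete4]]].
  have f4 : forall a k, ~~ (4 <= a <= 9)%N -> a != p -> imem s4 a k = imem s a k by case: os4.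
  apply: runs_iset; split; first by rewrite /= upd_other.
  split=> /=.
  - by case: os4 => f e1 e2 e3; split=> // a k H ap; rewrite /= !upd_other ?f //; lia.
  - by rewrite !upd_other.
  - by rewrite !upd_other.
  rewrite /row_prefix cS /=.
  have pp k : upd (upd (imem s4) 5 0 (imem s4 5 0 + imem s4 0 0)%N) 7 0 j.+1 p k = imem s4 p k.
    by rewrite !upd_other //; lia.
  split.
  - by rewrite !upd_other.
  - by rewrite upd_other // upd_same y5 f4 ?n_s //; lia.
  - by move=> k kd; rewrite pp low4.
  - by move=> k kd; rewrite pp high4.
  split.
  - by move=> t /sound4[j' H E]; exists j' => //; rewrite pp.
  - by move=> j' H /(complete4 j' H)[t tc E]; exists t => //; rewrite pp.
move=> s5 [os5 i5 b5 [_ _ low high [sound complete]]].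
have f5 : forall a k, ~~ (4 <= a <= 9)%N -> a != p -> imem s5 a k = imem s a k by case: os5.
have d5 : imem s5 0 2 = d by rewrite f5 //; lia.
apply: runs_iset; split; first by rewrite /= upd_other.
have pp k v w : upd (upd (imem s5) 9 0 v) 8 0 w p k = imem s5 p k.
  by rewrite !upd_other //; lia.
(* The in-degree bound keeps the row inside its [d] slots. *)
have cd := deg i lt_in.
split=> /=.
- by case: os5 => f e1 e2 e3; split=> // a k H ap; rewrite /= !upd_other ?f //; lia.
- by rewrite upd_other // upd_same b5 d5 mulSn addnC.
- by move=> k kd; rewrite pp high //; lia.
move=> i'; rewrite ltnS leq_eqVlt => /orP[/eqP->|lt_i].
  split.
    move=> t td; rewrite pp; have [tc|ct] := ltnP t (count (A^~ i) (iota 0 n)).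
      by right; apply: sound.
    by left; apply: high; lia.
  move=> j lt_jn Aji; have [t tc E] := complete j lt_jn Aji.
  by exists t; [lia | rewrite pp].
(* Earlier rows lie below [i * d], which this pass leaves untouched. *)
have [rs rc] := rows1 i' lt_i; have lowi t : (t < d)%N ->
  imem s5 p (i' * d + t) = imem s1 p (i' * d + t).
  by move=> td; apply: low; nia.
split=> [t td|j lt_jn Aji]; first by rewrite pp lowi //; apply: rs.
by have [t td E] := rc j lt_jn Aji; exists t => //; rewrite pp lowi.
Qed.

End ListParents.

(** * Learning and testing loops *)

Section Keys.
Variables (S : finType) (n : nat).
Implicit Types (x y : word S n).

Lemma size_encode x : size (encode x) = n.
Proof. by rewrite size_map size_enum_ord. Qed.

Lemma nth_encode x (i : 'I_n) : nth 0%N (encode x) i = enum_rank (x i).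
Proof. by rewrite (nth_map i) ?size_enum_ord // nth_ord_enum. Qed.

Lemma nth_encode_lt x k : (0 < #|S|)%N -> (nth 0%N (encode x) k < #|S|)%N.
Proof.
move=> S0; have [kn|nk] := ltnP k n; last by rewrite nth_default // size_encode.
by rewrite -[k]/(nat_of_ord (Ordinal kn)) nth_encode.
Qed.

Lemma nth_encode_inj x y (i : 'I_n) :
  (nth 0%N (encode x) i == nth 0%N (encode y) i) = (x i == y i).
Proof. by rewrite !nth_encode val_eqE (inj_eq enum_rank_inj). Qed.

Definition nat_edge (G : rel 'I_n) (a b : nat) : bool :=
  [exists i : 'I_n, exists j : 'I_n, [&& i == a :> nat, j == b :> nat & G i j]].

Lemma nat_edgeE G (i j : 'I_n) : nat_edge G i j = G i j.
Proof.
apply/existsP/idP => [[i' /existsP[j' /and3P[/eqP/val_inj-> /eqP/val_inj->]]] //|Gij].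
by exists i; apply/existsP; exists j; rewrite !eqxx.
Qed.

Lemma adjacencyE G a b : (a < n)%N -> (b < n)%N ->
  adjacency G (a * n + b) = nat_edge G a b.
Proof.
move=> an bn; congr nat_of_bool; apply: eq_existsb => i; apply: eq_existsb => j.
rewrite andbA; congr (_ && _); rewrite [(i == a :> nat)]eq_sym [(j == b :> nat)]eq_sym.
apply/eqP/andP => [E|[/eqP-> /eqP->] //].
have n0 : (0 < n)%N by lia.
have := congr1 (fun z => (z %/ n)%N) E; have := congr1 (fun z => (z %% n)%N) E.
by rewrite /= !divnMDl // !modnMDl !modn_small ?divn_small // !addn0 => -> ->.
Qed.

Lemma count_nat_edge G d (i : nat) : indegree_le G d -> (i < n)%N ->
  (count ((nat_edge G)^~ i) (iota 0 n) <= d)%N.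
Proof.
move=> deg lt_in; apply: leq_trans (deg (Ordinal lt_in)).
rewrite -val_enum_ord count_map cardE /enum_mem -enumT size_filter.
rewrite (@eq_count _ _ (mem (parents G (Ordinal lt_in)))) => [|j].
  by rewrite count_filter; apply: sub_count => j /andP[].
by rewrite /= -[i]/(nat_of_ord (Ordinal lt_in)) nat_edgeE inE.
Qed.

Variables (G : rel 'I_n) (d : nat) (par : nat -> nat).
Hypothesis (S0 : (0 < #|S|)%N).
Hypothesis rows : forall i, (i < n)%N -> lists_row n d (nat_edge G) par i.

Let pk x := pkey n #|S| d par (nth 0%N (encode x)).
Let fk x := fkey n #|S| d par (nth 0%N (encode x)).

(** The leading coefficient identifies the vertex, and the digits run through its parents because
    the list is sound and complete. Padding contributes the same digit for every word. *)
Lemma pkey_eq x y (i j : 'I_n) :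
  (pk x j == pk y i) = (j == i) && agree (parents G i) y x.
Proof.
rewrite /pk /pkey horner_key_inj; try by move=> t _; apply: nth_encode_lt.
rewrite -[(j == i :> nat)]/(j == i); case: eqP => //= ->.
have [sound complete] := rows (ltn_ord i).
apply/forallP/agreeP => [H j'|H [t td] /=].
  rewrite inE -nat_edgeE => Gji; have [t td tE] := complete _ (ltn_ord j') Gji.
  have /= := H (Ordinal td); rewrite tE subKn; last exact: ltnW.
  by rewrite nth_encode_inj => /eqP.
(* Padding reads cell n, just past the encoded word, where [nth] returns its default 0 on both
   sides. *)
have [->|[k /andP[kn Gki] ->]] := sound t td.
  by rewrite subn0 !nth_default ?size_encode.
rewrite subKn; last exact: ltnW.
rewrite -[k]/(nat_of_ord (Ordinal kn)) nth_encode_inj; apply/eqP/H.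
by rewrite inE -nat_edgeE.
Qed.

Lemma fkey_eq x y (i j : 'I_n) :
  (fk x j == fk y i) = (j == i) && agree (i |: parents G i) y x.
Proof.
(* A family key is a one-digit expansion over the parent key, so the same injectivity applies. *)
have E z k : fk z k = horner_key #|S| (fun=> nth 0%N (encode z) k) (pk z k) 1 by [].
rewrite !E horner_key_inj; try by move=> t _; apply: nth_encode_lt.
rewrite pkey_eq agreeU -andbA; case: eqP => //= ->; rewrite andbC; congr (_ && _).
apply/forallP/agreeP => [/(_ ord0)|H _].
  by rewrite nth_encode_inj => /eqP E' j'; rewrite inE => /eqP ->.
by rewrite nth_encode_inj H // inE.
Qed.

(** By injectivity of the keys only vertex [i] can hit this entry, so the table cell is the count in
    the denominator of [hcpt]. *)
Lemma sum_pkey xs y (i : 'I_n) :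
  (\sum_(x <- xs) \sum_(j < n) (pk x j == pk y i) = count (agree (parents G i) y) xs)%N.
Proof.
rewrite -sum1_count [RHS]big_mkcond; apply: eq_bigr => x _.
rewrite (bigD1 i) //= pkey_eq eqxx big1 ?addn0; first by case: (agree _ _ _).
by move=> j /negPf ji; rewrite pkey_eq ji.
Qed.

Lemma sum_fkey xs y (i : 'I_n) :
  (\sum_(x <- xs) \sum_(j < n) (fk x j == fk y i) = count (agree (i |: parents G i) y) xs)%N.
Proof.
rewrite -sum1_count [RHS]big_mkcond; apply: eq_bigr => x _.
rewrite (bigD1 i) //= fkey_eq eqxx big1 ?addn0; first by case: (agree _ _ _).
by move=> j /negPf ji; rewrite fkey_eq ji.
Qed.

Definition holds_counts (R : realType) (tp tf : nat) (xs : seq (word S n)) (s : state R) : Prop :=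
  (forall k, imem s tp k = (\sum_(x <- xs) \sum_(j < n) (pk x j == k))%N) /\
  (forall k, imem s tf k = (\sum_(x <- xs) \sum_(j < n) (fk x j == k))%N).

Lemma holds_counts_hnet (R : realType) tp tf xs (s : state R) y :
  holds_counts tp tf xs s ->
  \prod_(i < n) ((imem s tf (fk y i)).+1%:R / (imem s tp (pk y i) + #|S|)%:R) =
  hnet R G xs y.
Proof.
by move=> [hp hf]; apply: eq_bigr => i _; rewrite hp hf sum_pkey sum_fkey.
Qed.

End Keys.

(** The sample size cannot be obtained by rounding. Comparing the counter with a nonnegative real
    bound Y gives floor(Y) + 1 rounds and leaves that number in array 10, where the final average
    finds it. *)
Definition for_samples (c : cmd) : cmd :=
  Seq (assign 10 (INum 0))
      (While (BLeR (ROfNat (var 10)) (RGet 1 (INum 0))) (Seq c (increment 10))).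

Definition samples_of (R : realType) (src : source) (s : state R) : seq (seq nat) :=
  if src is Src1 then samples1 s else samples2 s.

Definition other (src : source) : source := if src is Src1 then Src2 else Src1.

Section SampleLoops.
Variables (R : realType).
Implicit Types s : state R.

Lemma runs_draw src a s x xs : samples_of src s = x :: xs ->
  runs (Draw src a) s (size x).+1 (fun s' =>
    [/\ imem s' = upd_block (imem s) a x, rmem s' = rmem s, samples_of src s' = xs &
        samples_of (other src) s' = samples_of (other src) s]).
Proof.
case: src => /= E; exists (size x).+1; eexists; split.
- exact: ExecDraw1 E.
- by [].
- by [].
- exact: ExecDraw2 E.
- by [].
- by [].
Qed.

Lemma runs_for_samples c N T (Y : R) (I : nat -> state R -> Prop) s :
  (forall k, (k%:R <= Y) = (k < N)%N) ->
  I 0%N (set_imem s (upd (imem s) 10 0 0)) ->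
  (forall k s', I k s' -> rmem s' 1 0 = Y) ->
  (forall k s', (k < N)%N -> imem s' 10 0 = k -> I k s' ->
     runs c s' T (fun s'' => imem s'' 10 0 = k /\
       I k.+1 (set_imem s'' (upd (imem s'') 10 0 k.+1)))) ->
  runs (for_samples c) s (N * (T + 2) + 2) (fun s' => imem s' 10 0 = N /\ I N s').
Proof.
move=> YN I0 rY step.
apply: runs_weaken (runs_seq (Q1 := fun s' => imem s' 10 0 = 0%N /\ I 0%N s')
   (T1 := 1) (T2 := (N * (T + 1).+1).+1) (Q2 := fun s' => imem s' 10 0 = N /\ I N s') _ _) _ _.
- by apply: runs_iset.
- move=> s' H; apply: (runs_while (I := fun k s' => imem s' 10 0 = k /\ I k s')) => //.
    move=> k {H}s' kN [vk Ik]; split; first by rewrite /= (rY _ _ Ik) vk YN.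
    apply: runs_seq (step k s' kN vk Ik) _ => s'' [vk' Ik'].
    by apply: runs_iset; rewrite /= vk' addn1.
  by move=> {H}s' [vN IN]; rewrite /= (rY _ _ IN) vN YN ltnn.
- by lia.
- by move=> s' [].
Qed.

Variables (S : finType) (n d : nat).
Implicit Types xs : seq (word S n).
Let q := #|S|.

Definition sweep_cost : nat := (n * (d * (3 * q + 6) + 3 * q + 12))%N.

Lemma runs_learn (par : nat -> nat) src p tp tf N (Y : R) xs s :
  (forall k, (k%:R <= Y) = (k < N)%N) -> rmem s 1 0 = Y ->
  (10 < p)%N -> (10 < tp)%N -> (10 < tf)%N -> p != tp -> p != tf -> tp != tf ->
  imem s 0 0 = n -> imem s 0 1 = q -> imem s 0 2 = d ->
  (forall k, (n <= k)%N -> imem s 3 k = 0%N) -> (forall k, imem s p k = par k) ->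
  (forall k, imem s tp k = 0%N) -> (forall k, imem s tf k = 0%N) ->
  samples_of src s = map (@encode S n) xs -> (N <= size xs)%N ->
  runs (for_samples (Seq (Draw src 3) (train p tp tf))) s
    (N * (n + sweep_cost + 6) + 2)
    (fun s' =>
      [/\ forall a k, ~~ (3 <= a <= 10)%N -> a != tp -> a != tf -> imem s' a k = imem s a k,
          rmem s' = rmem s, forall k, (n <= k)%N -> imem s' 3 k = 0%N,
          samples_of src s' = map (@encode S n) (drop N xs) /\
          samples_of (other src) s' = samples_of (other src) s &
          holds_counts d par tp tf (take N xs) s']).
Proof.
move=> YN rY p10 tp10 tf10 ptp ptf tptf e0 e1 e2 e3 ep etp etf es Nxs.
pose I k s' :=
      [/\ forall a k, ~~ (3 <= a <= 10)%N -> a != tp -> a != tf -> imem s' a k = imem s a k,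
          rmem s' = rmem s, forall k, (n <= k)%N -> imem s' 3 k = 0%N,
          samples_of src s' = map (@encode S n) (drop k xs) /\
          samples_of (other src) s' = samples_of (other src) s &
          holds_counts d par tp tf (take k xs) s'].
apply: (runs_weaken (runs_for_samples (I := I) (N := N) (T := (n.+1 + (sweep_cost + 3))%N) YN _ _ _)).
- rewrite /I take0 drop0; split=> //.
  + by move=> a k H ? ?; rewrite /= upd_other //; lia.
  + by split=> k; rewrite big_nil /= upd_other ?etp ?etf //; lia.
- by move=> k s' [_ -> _ _ _].
- move=> k s1 kN k1 [f1 r1 b1 [sm1 so1] [hp1 hf1]].
  have kxs : (k < size xs)%N by apply: leq_trans Nxs.
  case E: xs kxs => [//|x0 xs'] kxs; rewrite -E in kxs *.
  pose x := nth x0 xs k.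
  have dropE : drop k xs = x :: drop k.+1 xs by apply: drop_nth.
  rewrite dropE /= in sm1.
  have := runs_draw 3 sm1; rewrite size_encode => run_draw.
  apply: runs_seq run_draw _ => s2 [m2 r2 sm2 so2].
  have f2 a j : a != 3 -> imem s2 a j = imem s1 a j.
    by rewrite m2 /upd_block => /negPf ->.
  (* A draw writes only the first n cells, so cell n keeps the 0 on which padding relies. *)
  have b2 j : imem s2 3 j = nth 0%N (encode x) j.
    rewrite m2 /upd_block eqxx size_encode /=; case: ltnP => // nj.
    by rewrite b1 // nth_default // size_encode.
  have ctx : sweep_context n q d par (nth 0%N (encode x)) p s2.
    split=> [| | |//|j]; rewrite f2 ?f1 //; lia.
  have := @runs_train R n q d par _ p tp tf s2 ltac:(lia) ltac:(lia) ltac:(lia) ptp ptf tptf ctx.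
  move=> run_train; apply: runs_weaken run_train (leqnn _) _ => s3 [f3 p3 t3 [r3 s13 s23]].
  split; first by rewrite f3 ?f2 //; lia.
  split=> /=.
  + by move=> a j H ? ?; rewrite upd_other ?f3 ?f2 ?f1 //; lia.
  + by rewrite r3 r2.
  + move=> j nj; rewrite upd_other // f3 //; try lia.
    by rewrite b2 nth_default // size_encode.
  + by case: (src) sm2 so2 so1 => /= sm2 so2 so1; rewrite ?s13 ?s23 ?sm2 ?so2 ?so1.
  + have takeE : take k.+1 xs = rcons (take k xs) x by apply: take_nth.
    split=> j; rewrite takeE /= upd_other ?p3 ?t3 ?f2 ?hp1 ?hf1 ?big_rcons //; try lia.
- by lia.
- by move=> s' [].
Qed.

End SampleLoops.

(** * The complete program *)

Definition add_excess : cmd :=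
  Seq (evaluate 11 12 13 2)
  (Seq (evaluate 14 15 16 3)
       (If (BLeR (RGet 3 (INum 0)) (RGet 2 (INum 0)))
           (RSet 4 (INum 0)
              (RAdd (RGet 4 (INum 0))
                 (RSub (ROfNat (INum 1)) (RDiv (RGet 3 (INum 0)) (RGet 2 (INum 0))))))
           Skip)).

(* Real cell (1, 0) holds the bound that the sample counter has to exceed. *)
Definition set_bound : cmd :=
  Seq (RSet 1 (INum 0)
         (RDiv (RMul (ROfNat (INum 33)) (RMul (ROfNat nvar) (ROfNat sigma)))
               (RMul (RGet 0 (INum 0)) (RGet 0 (INum 0)))))
      (for_loop 7 degree
         (RSet 1 (INum 0) (RMul (RGet 1 (INum 0)) (ROfNat sigma)))).

(** With a single letter the two distributions coincide, and the output cell already holds 0. The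
    time bound forces the branch: loops over [d] parent slots are paid for by d < |S|^d, which fails
    for |S| = 1 as soon as d is positive. *)
Definition program : cmd :=
  If (BLeI sigma (INum 1)) Skip
  (Seq set_bound
  (Seq (list_parents 1 11)
  (Seq (list_parents 2 14)
  (Seq (for_samples (Seq (Draw Src1 3) (train 11 12 13)))
  (Seq (for_samples (Seq (Draw Src2 3) (train 14 15 16)))
  (Seq (for_samples (Seq (Draw Src1 3) add_excess))
       (RSet 0 (INum 1) (RDiv (RGet 4 (INum 0)) (ROfNat (var 10)))))))))).

Section RunProgram.
Variables (R : realType) (S : finType) (n d : nat) (G1 G2 : rel 'I_n).
Implicit Types (s : state R) (xs ys zs : seq (word S n)).
Let q := #|S|.
Hypothesis q2 : (1 < q)%N.
Hypotheses (deg1 : indegree_le G1 d) (deg2 : indegree_le G2 d).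

Lemma runs_test (par1 par2 : nat -> nat) N (Y : R) xs ys zs s :
  (forall i, (i < n)%N -> lists_row n d (nat_edge G1) par1 i) ->
  (forall i, (i < n)%N -> lists_row n d (nat_edge G2) par2 i) ->
  (forall k, (k%:R <= Y) = (k < N)%N) -> rmem s 1 0 = Y -> rmem s 4 0 = 0 ->
  imem s 0 0 = n -> imem s 0 1 = q -> imem s 0 2 = d ->
  (forall k, (n <= k)%N -> imem s 3 k = 0%N) ->
  (forall k, imem s 11 k = par1 k) -> (forall k, imem s 14 k = par2 k) ->
  holds_counts d par1 12 13 xs s -> holds_counts d par2 15 16 ys s ->
  samples1 s = map (@encode S n) zs -> size zs = N ->
  runs (for_samples (Seq (Draw Src1 3) add_excess)) s
    (N * (n + 2 * sweep_cost S n d + 13) + 2)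
    (fun s' => imem s' 10 0 = N /\
       rmem s' 4 0 = \sum_(z <- zs) excess (hnet R G1 xs z) (hnet R G2 ys z)).
Proof.
move=> rows1 rows2 YN rY r4 e0 e1 e2 e3 p1 p2 hc1 hc2 es sz.
pose I k s' :=
  [/\ forall a k, ~~ (3 <= a <= 10)%N -> imem s' a k = imem s a k,
      rmem s' 1 0 = Y, forall k, (n <= k)%N -> imem s' 3 k = 0%N,
      samples1 s' = map (@encode S n) (drop k zs) &
      rmem s' 4 0 = \sum_(z <- take k zs) excess (hnet R G1 xs z) (hnet R G2 ys z)].
apply: (runs_weaken (runs_for_samples (I := I) (N := N)
  (T := (n.+1 + (sweep_cost S n d + 4 + (sweep_cost S n d + 4 + 2)))%N) YN _ _ _)).
- rewrite /I take0 drop0 big_nil; split=> //.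
  by move=> a k H; rewrite /= upd_other //; lia.
- by move=> k s' [].
- move=> k s1 kN k1 [f1 r1 b1 sm1 a1].
  have kzs : (k < size zs)%N by rewrite sz.
  case E: zs kzs => [//|z0 zs'] kzs; rewrite -E in kzs *.
  pose z := nth z0 zs k.
  have dropE : drop k zs = z :: drop k.+1 zs by apply: drop_nth.
  rewrite dropE /= in sm1.
  have := @runs_draw R Src1 3 _ _ _ sm1; rewrite size_encode => run_draw.
  apply: runs_seq run_draw _ => s2 [m2 r2 sm2 _].
  have f2 a j : a != 3 -> imem s2 a j = imem s1 a j.
    by rewrite m2 /upd_block => /negPf ->.
  have b2 j : imem s2 3 j = nth 0%N (encode z) j.
    rewrite m2 /upd_block eqxx size_encode /=; case: ltnP => // nj.
    by rewrite b1 // nth_default // size_encode.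
  have ctx1 : sweep_context n q d par1 (nth 0%N (encode z)) 11 s2.
    by split=> [| | |//|j]; rewrite f2 ?f1 //; lia.
  have run1 := @runs_evaluate R n q d par1 _ 11 12 13 2 s2 isT isT isT ctx1.
  apply: runs_seq run1 _ => s3 [f3 r3 v3 s13 _].
  have ctx2 : sweep_context n q d par2 (nth 0%N (encode z)) 14 s3.
    by split=> [| | |j|j]; rewrite f3 ?b2 // f2 ?f1 //; lia.
  have run2 := @runs_evaluate R n q d par2 _ 14 15 16 3 s3 isT isT isT ctx2.
  apply: runs_seq run2 _ => s4 [f4 r4' v4 s14 _].
  have hc1' : holds_counts d par1 12 13 xs s2.
    by case: hc1 => h h'; split=> j; rewrite f2 // f1.
  have hc2' : holds_counts d par2 15 16 ys s3.
    by case: hc2 => h h'; split=> j; rewrite f3 // f2 // f1.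
  rewrite (holds_counts_hnet (ltnW q2) rows1 z hc1') in v3.
  rewrite (holds_counts_hnet (ltnW q2) rows2 z hc2') in v4.
  rewrite -r4' // in v3.
  have takeE : take k.+1 zs = rcons (take k zs) z by apply: take_nth.
  have k4 : imem s4 10 0 = k by rewrite f4 // f3 // f2.
  have keep s5 : imem s5 = imem s4 -> samples1 s5 = samples1 s4 ->
      rmem s5 1 0 = rmem s4 1 0 ->
      rmem s5 4 0 = rmem s4 4 0 + excess (hnet R G1 xs z) (hnet R G2 ys z) ->
      imem s5 10 0 = k /\ I k.+1 (set_imem s5 (upd (imem s5) 10 0 k.+1)).
    move=> i5 s15 r5 a5; rewrite i5; split=> //; split=> /=.
    + move=> a j H; rewrite upd_other ?f4 ?f3 ?f2 ?f1 //; lia.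
    + by rewrite r5 r4' // r3 // r2.
    + by move=> j nj; rewrite upd_other // f4 // f3 // b2 nth_default // size_encode.
    + by rewrite s15 s14 s13.
    + by rewrite a5 takeE big_rcons /= r4' // r3 // r2 a1.
  apply: runs_if => /=; rewrite v3 v4 => H.
    apply: runs_rset; apply: keep => //=.
    by rewrite upd_same /excess H v3 v4.
  apply: runs_skip; apply: keep => //.
  by rewrite /excess (negPf H) addr0.
- by lia.
- by move=> s' [k' [_ _ _ _ ->]]; rewrite take_oversize // sz.
Qed.

(** 33 = 3 * 11: the mean square error is at most 11 |S|^(d+1) n / N and has to be at most eps^2 /
    3. The factors come in the order in which the program multiplies them. *)
Definition bound (eps : R) : R := 33 * (n%:R * q%:R) / (eps * eps) * q%:R ^+ d.

Lemma runs_set_bound eps s :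
  imem s 0 1 = q -> imem s 0 0 = n -> imem s 0 2 = d -> rmem s 0 0 = eps ->
  runs set_bound s (d * 3 + 3) (fun s' =>
   [/\ forall a k, ~~ (4 <= a <= 9)%N -> imem s' a k = imem s a k,
       forall a k, a != 1%N -> rmem s' a k = rmem s a k,
       rmem s' 1 0 = bound eps, samples1 s' = samples1 s & samples2 s' = samples2 s]).
Proof.
move=> e1 e0 e2 eE; apply: (runs_weaken (T := (1 + (d * (1 + 2) + 2))%N)); [|lia|by move=> s';
  exact].
apply: runs_seq; first by apply: runs_rset; exact: erefl.
move=> _ <-.
apply: (runs_weaken (runs_for (N := d) (I := fun k s' =>
   [/\ forall a k, ~~ (4 <= a <= 9)%N -> imem s' a k = imem s a k,
       forall a k, a != 1%N -> rmem s' a k = rmem s a k,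
       rmem s' 1 0 = 33 * (n%:R * q%:R) / (eps * eps) * q%:R ^+ k,
       samples1 s' = samples1 s & samples2 s' = samples2 s]) _ _ _)) => [|||//|//].
- split=> //=.
  + by move=> a k H; rewrite upd_other //; lia.
  + by move=> a k /eqP H; rewrite upd_other.
  + by rewrite upd_same e0 e1 eE expr0 mulr1.
- by move=> k s' _ [f _ _ _ _] /=; rewrite f.
- move=> k s1 kd k7 [f1 r1 v1 s11 s12]; apply: runs_rset; split=> //; split=> //=.
  + by move=> a j H; rewrite upd_other ?f1 //; lia.
  + by move=> a j H; rewrite upd_other ?r1 //; apply/eqP.
  + by rewrite upd_same v1 f1 // e1 exprSr [RHS]mulrA.
Qed.

Lemma runs_program eps N xs ys bs :
  (forall k, (k%:R <= bound eps) = (k < N)%N) ->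
  (N + N)%N = size xs -> (N + N)%N = size ys ->
  runs program (init (network_input q d G1 G2) eps xs ys bs)
    (d * 3 + 3 + (n * (n * 7 + 9) + 3 + (n * (n * 7 + 9) + 3 +
      (N * (n + sweep_cost S n d + 6) + 2 + (N * (n + sweep_cost S n d + 6) + 2 +
      (N * (n + 2 * sweep_cost S n d + 13) + 2 + 1))))) + 1)
    (fun s' => rmem s' 0 1 = estimate R G1 G2 (take N xs) (take N ys) (drop N xs)).
Proof.
move=> YN xsN ysN; set s0 := init _ _ _ _ _.
rewrite addn1; apply: runs_if => /= [q1|_]; first by move: q2; rewrite ltnNge q1.
apply: runs_seq (@runs_set_bound eps s0 erefl erefl erefl erefl) _ => s1 [f1 r1 v1 s11 s12].
have adj (G : rel 'I_n) i j : (i < n)%N -> (j < n)%N -> adjacency G (j * n + i) = nat_edge G j i.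
  by move=> ? ?; apply: adjacencyE.
have run2 := @runs_list_parents R n d (nat_edge G1) 1 11 s1 isT isT.
apply: runs_seq (run2 _ _ _ _ _) _.
- by rewrite f1.
- by rewrite f1.
- by move=> i j ? ?; rewrite f1 //= adj.
- by move=> k; rewrite f1.
- by move=> i; apply: count_nat_edge.
move=> s2 [[f2 r2 s21 s22] rows1].
have run3 := @runs_list_parents R n d (nat_edge G2) 2 14 s2 isT isT.
apply: runs_seq (run3 _ _ _ _ _) _.
- by rewrite f2 // f1.
- by rewrite f2 // f1.
- by move=> i j ? ?; rewrite f2 // f1 //= adj.
- by move=> k; rewrite f2 // f1.
- by move=> i; apply: count_nat_edge.
move=> s3 [[f3 r3 s31 s32] rows2].
pose par1 := imem s2 11; pose par2 := imem s3 14.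
have init3 a k : ~~ (4 <= a <= 9)%N -> a != 11%N -> a != 14%N ->
  imem s3 a k = network_input q d G1 G2 a k.
  by move=> ? ? ?; rewrite f3 // f2 // f1.
have Nxs : (N <= size xs)%N by lia.
have Nys : (N <= size ys)%N by lia.
have v3 : rmem s3 1 0 = bound eps by rewrite r3 r2.
have run4 := @runs_learn R S n d par1 Src1 11 12 13 N (bound eps) xs s3 YN v3
  isT isT isT isT isT isT.
apply: runs_seq (run4 _ _ _ _ _ _ _ _ Nxs) _.
- by rewrite init3.
- by rewrite init3.
- by rewrite init3.
- by move=> k _; rewrite init3.
- by move=> k; rewrite f3.
- by move=> k; rewrite init3.
- by move=> k; rewrite init3.
- by rewrite /= s31 s21 s11.
move=> s4 [f4 r4 b4 [s41 s42] hc4].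
have run5 := @runs_learn R S n d par2 Src2 14 15 16 N (bound eps) ys s4 YN.
apply: runs_seq (run5 _ _ _ _ _ _ _ _ _ _ _ _ _ _ _ Nys) _ => //.
- by rewrite r4.
- by rewrite f4 // init3.
- by rewrite f4 // init3.
- by rewrite f4 // init3.
- by move=> k; rewrite f4.
- by move=> k; rewrite f4 // init3.
- by move=> k; rewrite f4 // init3.
- by rewrite s42 /= s32 s22 s12.
move=> s5 [f5 r5 b5 [_ s51] hc5].
have run6 := @runs_test par1 par2 N (bound eps) (take N xs) (take N ys) (drop N xs) s5
  rows1 rows2 YN.
apply: runs_seq (run6 _ _ _ _ _ _ _ _ _ _ _ _) _ => //.
- by rewrite r5 r4.
- by rewrite r5 r4 r3 r2 r1.
- by rewrite f5 // f4 // init3.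
- by rewrite f5 // f4 // init3.
- by rewrite f5 // f4 // init3.
- by move=> k; rewrite f5 // f4 // f3.
- by move=> k; rewrite f5 // f4.
- by case: hc4 => h h'; split=> k; rewrite f5.
- by rewrite [LHS]s51 s41.
- by rewrite size_drop -xsN addnK.
move=> s6 [k6 v6]; apply: runs_rset; rewrite /= upd_same v6 k6 /estimate.
by rewrite size_drop -xsN addnK.
Qed.

End RunProgram.

(** * Success probability *)

Lemma Eiid_swap (R : realType) (T U : finType) (P : T -> R) (Q : U -> R) a b
    (F : seq T -> seq U -> R) :
  Eiid P a (fun s => Eiid Q b (F s)) = Eiid Q b (fun t => Eiid P a (F^~ t)).
Proof.
elim: a F => [|a IH] F //; rewrite EiidS.
under [RHS]eq_Eiid => t _ do rewrite EiidS.
by rewrite Eiid_sum; apply: eq_bigr => x _; rewrite EiidZ IH.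
Qed.

(** [F] ignores the coins, whose 2^t equally weighted sequences have total weight 1. *)
Lemma sum_iid_coins (R : realType) (T : finType) (P Q : T -> R) a b t
    (F : seq T -> seq T -> R) :
  \sum_(w : a.-tuple T * b.-tuple T * t.-tuple bool)
     iid P w.1.1 * iid Q w.1.2 * 2^-1 ^+ t * F w.1.1 w.1.2 =
  Eiid P a (fun xs => Eiid Q b (F xs)).
Proof.
rewrite -(pair_bigA _ (fun (p : a.-tuple T * b.-tuple T) (bs : t.-tuple bool) =>
  iid P p.1 * iid Q p.2 * 2^-1 ^+ t * F p.1 p.2)) /=.
transitivity (\sum_(p : a.-tuple T * b.-tuple T) iid P p.1 * (iid Q p.2 * F p.1 p.2)).
  apply: eq_bigr => p _; rewrite sumr_const card_tuple card_bool -[LHS]mulr_natl natrX.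
  have t0 : 2 ^+ t != 0 :> R by rewrite expf_neq0 // pnatr_eq0.
  by rewrite exprVn; field.
rewrite -(pair_bigA _ (fun (xs : a.-tuple T) (ys : b.-tuple T) =>
  iid P xs * (iid Q ys * F xs ys))) /= -Eiid_tuple.
apply: eq_bigr => xs _; rewrite -mulr_sumr; congr (_ * _).
by rewrite -Eiid_tuple.
Qed.

(** Markov's inequality in pointwise form: 1 - (F - c)^2 / eps^2 is at most 1 everywhere and at most
    0 off the good set, while its expectation is at least 2/3. *)
Lemma success_probability_ge (R : realType) (T : finType) (P Q : T -> R) a b t
    (F : seq T -> seq T -> R) (c eps : R)
    (good : pred (a.-tuple T * b.-tuple T * t.-tuple bool)) :
  (forall x, 0 <= P x) -> \sum_x P x = 1 -> (forall x, 0 <= Q x) -> \sum_x Q x = 1 ->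
  0 < eps ->
  (forall w : a.-tuple T * b.-tuple T * t.-tuple bool, `|F w.1.1 w.1.2 - c| <= eps -> good w) ->
  Eiid P a (fun xs => Eiid Q b (fun ys => (F xs ys - c) ^+ 2)) <= eps ^+ 2 / 3 ->
  2 / 3 <= \sum_(w | good w) iid P w.1.1 * iid Q w.1.2 * 2^-1 ^+ t.
Proof.
move=> P0 P1 Q0 Q1 e0 goodP small.
pose H xs ys : R := 1 - eps ^- 2 * (F xs ys - c) ^+ 2.
have HE : Eiid P a (fun xs => Eiid Q b (H xs)) =
    1 - eps ^- 2 * Eiid P a (fun xs => Eiid Q b (fun ys => (F xs ys - c) ^+ 2)).
  rewrite -EiidZ -mulN1r -EiidZ -[X in X + _](Eiid_cst P1 a) -EiidD; apply: eq_Eiid => xs _.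
  rewrite -EiidZ -EiidZ -[X in X + _](Eiid_cst Q1 b) -EiidD; apply: eq_Eiid => ys _.
  by rewrite mulN1r.
apply: (@le_trans _ _ (Eiid P a (fun xs => Eiid Q b (H xs)))).
  have e2 : 0 < eps ^+ 2 by rewrite exprn_gt0.
  have := ler_wpM2l (ltW (_ : 0 < eps ^- 2)) small; rewrite invr_gt0 => /(_ e2).
  rewrite mulrA mulVf ?gt_eqF // mul1r HE; lra.
rewrite -(sum_iid_coins P Q a b t) [leRHS]big_mkcond; apply: ler_sum => w _.
have w0 : 0 <= iid P w.1.1 * iid Q w.1.2 * 2^-1 ^+ t.
  by rewrite !mulr_ge0 ?exprn_ge0 ?invr_ge0 //; apply: prodr_ge0.
have [_|bad] := ifP.
  rewrite -[leRHS]mulr1 ler_wpM2l // gerBl mulr_ge0 ?sqr_ge0 //.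
  by rewrite invr_ge0 exprn_ge0 // ltW.
apply: mulr_ge0_le0 => //; rewrite subr_le0 mulrC ler_pdivlMr ?exprn_gt0 // mul1r.
rewrite -[leRHS]real_normK ?num_real //; apply: lerXn2r; rewrite ?nnegrE ?(ltW e0) //.
by rewrite leNgt; apply: contraFN bad => /ltW; apply: goodP.
Qed.

(** Setup costs of order n^2 and d are absorbed by n <= N and d < q^d. The work per vertex and
    sample is of order (d + 1) q, which q^(d+1) dominates. *)
Lemma program_time_le (n q d N : nat) (S : finType) :
  #|S| = q -> (1 < q)%N -> (0 < n)%N -> (n <= N)%N ->
  (d * 3 + 3 + (n * (n * 7 + 9) + 3 + (n * (n * 7 + 9) + 3 +
      (N * (n + sweep_cost S n d + 6) + 2 + (N * (n + sweep_cost S n d + 6) + 2 +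
      (N * (n + 2 * sweep_cost S n d + 13) + 2 + 1))))) + 1 <=
   200 * (q ^ d.+1 * (N + N) * n))%N.
Proof.
move=> Sq q2 n0 nN; rewrite /sweep_cost Sq.
have dq : (d < q ^ d)%N by apply: ltn_expl.
set W := (q ^ d.+1)%N; have WE : W = (q * q ^ d)%N by rewrite /W expnS.
have dqW : (d * q <= W)%N by nia.
have qW : (q <= W)%N by rewrite WE leq_pmulr // expn_gt0 (ltnW q2).
have dW : (d <= W)%N by nia.
have W2 : (2 <= W)%N by lia.
set B := (n * (d * (3 * q + 6) + 3 * q + 12))%N.
have BW : (B <= 15 * (W * n))%N.
  have : (d * (3 * q + 6) + 3 * q + 12 <= 15 * W)%N by nia.
  move=> H; apply: (@leq_trans (n * (15 * W))%N); last by lia.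
  by rewrite leq_mul2l H orbT.
have nW : (2 * n <= W * n)%N by rewrite leq_mul2r W2 orbT.
set Z := (W * n)%N in BW nW *; have Zn : (n <= Z)%N by lia.
have -> : (W * (N + N) * n = 2 * (N * Z))%N by rewrite /Z; lia.
have NZ : (Z <= N * Z)%N by rewrite leq_pmull //; lia.
have WZ : (W <= Z)%N by rewrite /Z leq_pmulr.
have H1 : (N * (n + B + 6) <= N * (19 * Z))%N by rewrite leq_mul2l; apply/orP; right; lia.
have H2 : (N * (n + 2 * B + 13) <= N * (38 * Z))%N by rewrite leq_mul2l; apply/orP; right; lia.
have H3 : (n * (n * 7 + 9) <= N * (8 * Z + Z))%N by apply: leq_mul => //; lia.
lia.
Qed.

(* One program, one sample-size function and one set of constants serve all
   alphabets, graphs and accuracies. *)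
Theorem theorem2p4 (R : realType) :
  exists (c : cmd) (m : nat -> nat -> nat -> R -> nat) (C k K : nat),
    (forall (n sigma d : nat) (eps : R),
       (0 < n)%N -> (0 < sigma)%N -> 0 < eps < 1 ->
       let X := sigma%:R ^+ d.+1 * n%:R * eps ^- 2 in
       (m n sigma d eps)%:R <= C%:R * X * ln (X + 2) ^+ k) /\
    (forall (Sigma : finType) (n d : nat) (G1 G2 : rel 'I_n),
       (0 < n)%N ->
       acyclic G1 -> acyclic G2 -> indegree_le G1 d -> indegree_le G2 d ->
       distance_approximation
         (@bayes_net R Sigma n G1) (@bayes_net R Sigma n G2)
         c (network_input #|Sigma| d G1 G2)
         (fun eps => m n #|Sigma| d eps)
         (fun eps => K * (#|Sigma| ^ d.+1 * m n #|Sigma| d eps * n))%N).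
Proof.
pose Y n q d (eps : R) : R := 33 * (n%:R * q%:R) / (eps * eps) * q%:R ^+ d.
pose N n q d eps := (Num.truncn (Y n q d eps)).+1.
have YE n q d eps : Y n q d eps = 33 * (q%:R ^+ d.+1 * n%:R * eps ^- 2).
  by rewrite /Y exprS -expr2; ring.
have X1 n q d eps : (0 < n)%N -> (0 < q)%N -> 0 < eps < 1 ->
    n%:R <= q%:R ^+ d.+1 * n%:R * eps ^- 2 :> R.
  move=> n0 q0 /andP[e0 e1]; rewrite -natrX -natrM ler_pdivlMr ?exprn_gt0 //.
  apply: (@le_trans _ _ n%:R); last by rewrite ler_nat leq_pmull // expn_gt0 q0.
  by rewrite -[leRHS]mulr1 ler_wpM2l // exprn_ile1 // ltW.
have Y0 n q d eps : (0 < n)%N -> (0 < q)%N -> 0 < eps < 1 -> 0 <= Y n q d eps.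
  by move=> n0 q0 e01; rewrite YE mulr_ge0 //; apply: le_trans (X1 _ _ _ _ n0 q0 e01).
(* Here m = 2 N, as the first source supplies N training and N test samples. Since N <= 33 X + 1 <=
   34 X, the constant is 68 and the logarithm has exponent 0. *)
exists program, (fun n q d eps => N n q d eps + N n q d eps)%N, 68%N, 0%N, 200%N.
split=> [n q d eps n0 q0 e01|S n d G1 G2 n0 ac1 ac2 deg1 deg2 eps e01 P Q netP netQ].
  cbv zeta; set X := _ * n%:R * _.
  rewrite expr0 mulr1 /N natrD -natr1.
  have := truncn_itv (Y0 n q d eps n0 q0 e01) => /andP[lo _].
  have X_ge1 : 1 <= X by apply: le_trans (X1 _ _ _ _ n0 q0 e01); rewrite ler1n.
  rewrite YE -/X in lo; rewrite YE -/X; lra.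
have P0 := netP_ge0 netP; have P1 := netP_sum1 netP.
have Q0 := netP_ge0 netQ; have Q1 := netP_sum1 netQ.
have e0 : 0 < eps by case/andP: e01.
have [x0] := sum1_inhabited P1.
have S0 : (0 < #|S|)%N by apply/card_gt0P; exists (x0 (Ordinal n0)).
set M := N n #|S| d eps.
(* One letter: there is a single word, and [P] and [Q] are both its point mass. *)
have [S1|q2] := leqP #|S| 1.
  have word1 (x : word S n) : x = x0.
    by apply/ffunP => i; have /fintype_le1P H := S1; apply: H.
  have const1 (F : word S n -> R) : \sum_x F x = 1 -> forall x, F x = 1.
    by move=> <- x; rewrite (big_pred1 x0) ?(word1 x) // => y; rewrite /= (word1 y) eqxx.
  have dTV0 : dTV P Q = 0.
    by rewrite /dTV big1 ?mulr0 // => x _; rewrite !const1 // subrr normr0.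
  have run (xs ys : (M + M).-tuple (word S n)) bs :
      returns program (init (network_input #|S| d G1 G2) eps xs ys bs)
        (200 * (#|S| ^ d.+1 * (M + M) * n)) 0.
    have [t [s' [ex le eq]]] : runs program (init (network_input #|S| d G1 G2) eps xs ys bs) 2
        (fun s' => rmem s' 0 1 = 0).
      by apply: (runs_if (T := 1)) => [_|/=]; [apply: runs_skip | rewrite S1].
    exists t, s'; split=> //; apply: leq_trans le _.
    have : (0 < #|S| ^ d.+1 * (M + M) * n)%N by rewrite !muln_gt0 expn_gt0 S0 n0.
    by lia.
  split=> [xs ys bs|]; first by exists 0; rewrite ?lexx ?ler01 //; apply: run.
  apply: (success_probability_ge (F := fun _ _ => 0) (c := 0) (eps := eps)) => //.
    move=> w _; apply/asboolP; exists 0; first exact: run.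
    by rewrite dTV0 sub0r add0r oppr_le0 ltW.
  rewrite subrr expr2 mulr0 !Eiid_cst //.
  by rewrite divr_ge0 ?sqr_ge0.
have YM k : (k%:R <= Y n #|S| d eps) = (k < M)%N.
  by rewrite ltnS truncn_ge_nat // Y0.
(* Lets the running time absorb the n^2 cost of the parent lists. *)
have nM : (n <= M)%N.
  have H := X1 n #|S| d eps n0 S0 e01; apply: ltnW; rewrite -YM YE.
  apply: (le_trans H); rewrite ler_peMl ?ler1n //.
  by apply: le_trans H; apply: ler0n.
have run (xs ys : (M + M).-tuple (word S n)) bs :
    returns program (init (network_input #|S| d G1 G2) eps xs ys bs)
      (200 * (#|S| ^ d.+1 * (M + M) * n))
      (estimate R G1 G2 (take M xs) (take M ys) (drop M xs)).
  have [||t [s' [ex le eq]]] := @runs_program R S n d G1 G2 q2 deg1 deg2 eps M xs ys bs YM.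
  - by rewrite size_tuple.
  - by rewrite size_tuple.
  exists t, s'; split=> //; apply: leq_trans le _.
  exact: program_time_le.
split=> [xs ys bs|].
  by exists (estimate R G1 G2 (take M xs) (take M ys) (drop M xs));
    [apply: estimate01 | apply: run].
apply: (success_probability_ge (c := dTV P Q) (eps := eps)
  (F := fun xs ys => estimate R G1 G2 (take M xs) (take M ys) (drop M xs))) => //.
  move=> w close; apply/asboolP; eexists; first exact: run.
  by move: close; rewrite ler_norml => /andP[? ?]; apply/andP; split; lra.
(* The first halves train and the second half of the [P] samples tests; the spare half of the [Q]
   samples integrates out. *)
have -> : Eiid P (M + M) (fun xs => Eiid Q (M + M) (fun ys =>
    (estimate R G1 G2 (take M xs) (take M ys) (drop M xs) - dTV P Q) ^+ 2)) =
  Eiid P M (fun xs => Eiid Q M (fun ys => Eiid P M (fun zs =>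
    (estimate R G1 G2 xs ys zs - dTV P Q) ^+ 2))).
  rewrite Eiid_cat; apply: eq_Eiid => xs sx.
  rewrite [RHS]Eiid_swap; apply: eq_Eiid => zs _.
  rewrite Eiid_cat; apply: eq_Eiid => ys sy.
  under eq_Eiid => ts _ do rewrite !take_cat sx sy !ltnn subnn !take0 !cats0 drop_cat sx ltnn subnn drop0.
  by rewrite Eiid_cst.
apply: (le_trans (Eiid_estimate_sq_le S0 ac1 ac2 deg1 deg2 netP netQ _ n0)) => //.
have /ltW := truncnS_gt (Y n #|S| d eps); rewrite -/(N n #|S| d eps) -/M YE.
have M0 : 0 < M%:R :> R by rewrite ltr0n.
rewrite ler_pdivrMr // => H.
have e2 : 0 < eps ^+ 2 by rewrite exprn_gt0.
have := ler_wpM2l (ltW e2) H.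
set A := _ * n%:R; have -> : eps ^+ 2 * (33 * (A / eps ^+ 2)) = 33 * A.
  by field; rewrite gt_eqF.
lra.
Qed.
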